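(* For every $R\ge1$ there is a positive constant $C_R$, depending only on $R$, such that the following holds. Let $d,n,N\in\mathbb{N}$ with $n\le(3/4)N$ and $N\ge n^3/d^2$. Let $$\Theta_R=\left\{\boldsymbol{p}\in N^{-1}\,\mathbb{N}_0^d\cap\mathrm{Int}(\mathcal{S}_d):\ \frac{\max\{p_1,\dots,p_d,p_{d+1}\}}{\min\{p_1,\dots,p_d,p_{d+1}\}}\le R\right\},$$ and define the experiments $$\mathscr{P}=\{\mathbb{P}_{N,n,\boldsymbol{p}}\}_{\boldsymbol{p}\in\Theta_R},\quad \mathbb{P}_{N,n,\boldsymbol{p}}\text{ the measure induced by }\mathrm{Hypergeometric}(N,n,\boldsymbol{p}),$$ $$\mathscr{Q}=\{\mathbb{Q}_{n,\boldsymbol{p}}\}_{\boldsymbol{p}\in\Theta_R},\quad \mathbb{Q}_{n,\boldsymbol{p}}\text{ the measure induced by }\mathrm{Normal}_d(n\boldsymbol{p},n\Sigma_{\boldsymbol{p}}),$$ where $\Sigma_{\boldsymbol{p}}=\mathrm{diag}(\boldsymbol{p})-\boldsymbol{p}\boldsymbol{p}^\top$. Then the Le Cam distance between $\mathscr{P}$ and $\mathscr{Q}$ satisfies $$\Delta(\mathscr{P},\mathscr{Q})=\max\{\delta(\mathscr{P},\mathscr{Q}),\delta(\mathscr{Q},\mathscr{P})\}\le C_R\,\frac{d}{\sqrt n},$$ where $$\delta(\mathscr{P},\mathscr{Q})=\inf_{T_1}\sup_{\boldsymbol{p}\in\Theta_R}\left\|\int T_1(\boldsymbol{k},\cdot)\,\mathbb{P}_{N,n,\boldsymbol{p}}(\mathrm{d}\boldsymbol{k})-\mathbb{Q}_{n,\boldsymbol{p}}\right\|,$$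 $$\delta(\mathscr{Q},\mathscr{P})=\inf_{T_2}\sup_{\boldsymbol{p}\in\Theta_R}\left\|\mathbb{P}_{N,n,\boldsymbol{p}}-\int_{\mathbb{R}^d}T_2(\boldsymbol{z},\cdot)\,\mathbb{Q}_{n,\boldsymbol{p}}(\mathrm{d}\boldsymbol{z})\right\|,$$ $\|\cdot\|$ is the total variation norm, and the infima are taken over all Markov kernels $T_1$ from $\mathbb{N}_0^d\cap n\mathcal{S}_d$ to $\mathbb{R}^d$ and all Markov kernels $T_2$ from $\mathbb{R}^d$ to $\mathbb{N}_0^d\cap n\mathcal{S}_d$, respectively.
   Context: $\mathbb{N}=\{1,2,\dots\}$, $\mathbb{N}_0=\mathbb{N}\cup\{0\}$, and $\|\boldsymbol{x}\|_1=\sum_{i=1}^d|x_i|$ on $\mathbb{R}^d$. The simplex and its interior are $\mathcal{S}_d=\{\boldsymbol{x}\in[0,1]^d:\|\boldsymbol{x}\|_1\le1\}$ and $\mathrm{Int}(\mathcal{S}_d)=\{\boldsymbol{x}\in(0,1)^d:\|\boldsymbol{x}\|_1<1\}$. For $\boldsymbol{p}\in\mathrm{Int}(\mathcal{S}_d)$ put $p_{d+1}=1-\|\boldsymbol{p}\|_1>0$, and for $\boldsymbol{k}\in\mathbb{N}_0^d\cap n\mathcal{S}_d$ put $k_{d+1}=n-\|\boldsymbol{k}\|_1$. For $\boldsymbol{p}\in N^{-1}\mathbb{N}_0^d\cap\mathrm{Int}(\mathcal{S}_d)$, $\mathrm{Hypergeometric}(N,n,\boldsymbol{p})$ is the distribution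 with probability mass function $$P_{N,n,\boldsymbol{p}}(\boldsymbol{k})=\frac{\prod_{i=1}^{d+1}\binom{Np_i}{k_i}}{\binom Nn},\qquad \boldsymbol{k}\in\mathbb{K}_d=\{\boldsymbol{k}\in\mathbb{N}_0^d\cap n\mathcal{S}_d: k_i\in[0,Np_i]\text{ for all }1\le i\le d+1\},$$ regarded as a probability measure on the finite set $\mathbb{N}_0^d\cap n\mathcal{S}_d$ (with zero mass outside $\mathbb{K}_d$). $\mathrm{Normal}_d(\boldsymbol{\mu},\Sigma)$ is the $d$-dimensional normal distribution with mean $\boldsymbol{\mu}$ and covariance matrix $\Sigma$. Here $\mathbb{R}^d$ carries its Borel $\sigma$-algebra. *)

(* Defs.v *)
From HB Require Import structures.
From mathcomp Require Import all_boot all_order all_algebra.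
From mathcomp Require Import all_classical all_reals all_analysis.
From mathcomp Require Import measurable_realfun.

Set Implicit Arguments.
Unset Strict Implicit.
Unset Printing Implicit Defensive.

Import Order.TTheory GRing.Theory Num.Theory.
Import numFieldNormedType.Exports.

Local Open Scope classical_set_scope.
Local Open Scope ring_scope.

Section simplex.
Context {R : realType}.

Definition norm1 d (x : 'rV[R]_d) : R := \sum_(i < d) `|x 0 i|.

Definition int_simplex d : set 'rV[R]_d :=
  [set x : 'rV[R]_d | (forall i, 0 < x 0 i < 1) /\ norm1 x < 1].

Definition barycentric d (p : 'rV[R]_d) (i : 'I_d.+1) : R :=
  if unlift ord_max i is Some j then p 0 j else 1 - norm1 p.

(* On the open simplex all d+1 weights lie in (0, 1), so that the neutral
   elements 0 and 1 do not affect the maximum and the minimum. *)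
Definition max_weight d (p : 'rV[R]_d) : R :=
  \big[Num.max/0]_(i < d.+1) barycentric p i.
Definition min_weight d (p : 'rV[R]_d) : R :=
  \big[Num.min/1]_(i < d.+1) barycentric p i.

Definition Theta (d N : nat) (r : R) : set 'rV[R]_d :=
  [set p : 'rV[R]_d | [/\ exists m : 'I_d -> nat, forall i, p 0 i = (m i)%:R / N%:R,
               int_simplex p
             & max_weight p / min_weight p <= r]].

End simplex.
Arguments Theta {R} d N r.

(* The integer points k of the dilated simplex n S_d; as 0 <= k_i <= n, the
   coordinates are taken in 'I_n.+1. *)
Definition lattice_simplex (d n : nat) : Type :=
  {k : {ffun 'I_d -> 'I_n.+1} | (\sum_(i < d) k i <= n)%N}.

HB.instance Definition _ d n := Finite.on (lattice_simplex d n).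

Section lattice_simplex_measurable.
Variables d n : nat.

Let origin_proof : (\sum_(i < d) [ffun=> @ord0 n] i <= n)%N.
Proof. by rewrite big1// => i _; rewrite ffunE. Qed.

HB.instance Definition _ := isPointed.Build (lattice_simplex d n)
  (Sub [ffun=> @ord0 n] origin_proof).

HB.instance Definition _ := @isMeasurable.Build default_measure_display
  (lattice_simplex d n) discrete_measurable discrete_measurable0
  discrete_measurableC discrete_measurableU.

End lattice_simplex_measurable.

Definition lattice_barycentric d n (k : lattice_simplex d n)
    (i : 'I_d.+1) : nat :=
  if unlift ord_max i is Some j then val k j
  else (n - \sum_(j < d) val k j)%N.

Section hypergeometric.
Context {R : realType}.
Variables (d N n : nat) (p : 'rV[R]_d).

(* For p in N^-1 N_0^d the number N p_i is a natural number and [Num.truncn]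
   merely reads it off; the mass vanishes as soon as some k_i > N p_i because
   the corresponding binomial coefficient does. *)
Definition hypergeometric_pmf (k : lattice_simplex d n) : R :=
  (\prod_(i < d.+1)
     'C(Num.truncn (N%:R * barycentric p i), lattice_barycentric k i))%:R
  / 'C(N, n)%:R.

Lemma hypergeometric_pmf_ge0 k : 0 <= hypergeometric_pmf k.
Proof. by rewrite divr_ge0 ?ler0n. Qed.

Definition hypergeometric (U : set (lattice_simplex d n)) : \bar R :=
  (\esum_(k in U) (hypergeometric_pmf k)%:E)%E.

Local Open Scope ereal_scope.

Let hypergeometric0 : hypergeometric set0 = 0.
Proof. exact: esum_set0. Qed.

Let hypergeometric_ge0 U : 0 <= hypergeometric U.
Proof. by apply: esum_ge0 => k _; rewrite lee_fin hypergeometric_pmf_ge0. Qed.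

Let hypergeometric_sigma_additive : semi_sigma_additive hypergeometric.
Proof.
move=> F mF tF mUF; rewrite /hypergeometric; apply: cvg_toP.
  apply: ereal_nondecreasing_is_cvgn => a b ab.
  by apply: lee_sum_nneg_natr => // k _ _; exact: hypergeometric_ge0.
by rewrite nneseries_sum_bigcup// => i; rewrite lee_fin hypergeometric_pmf_ge0.
Qed.

HB.instance Definition _ := isMeasure.Build _ _ _ hypergeometric
  hypergeometric0 hypergeometric_ge0 hypergeometric_sigma_additive.

End hypergeometric.
Arguments hypergeometric_pmf {R d} N n p k.
Arguments hypergeometric {R d} N n p U.

(* R^d as a measurable space is [d.-tuple R] with its product sigma-algebra,
   which is the Borel sigma-algebra of R^d: see [measurable_tuple_borel]. *)
Section lebesgue_tuple.
Context {R : realType}.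
Local Notation RR := (measurableTypeR R).

Definition tuple_cons n (x : RR * n.-tuple RR) : n.+1.-tuple RR :=
  [the n.+1.-tuple RR of x.1 :: x.2].

Lemma measurable_tuple_cons n : measurable_fun [set: _] (@tuple_cons n).
Proof. exact: measurable_cons. Qed.

Definition tuple_uncons n (t : n.+1.-tuple RR) : RR * n.-tuple RR :=
  (thead t, [tuple of behead t]).

Lemma measurable_tuple_uncons n : measurable_fun [set: _] (@tuple_uncons n).
Proof.
apply: measurable_fun_pair; last exact: measurable_behead.
exact: measurable_tnth.
Qed.

Section cons_measure.
Variables (n : nat) (m : {sigma_finite_measure set (n.-tuple RR) -> \bar R}).

Definition cons_measure : set (n.+1.-tuple RR) -> \bar R :=
  pushforward (@lebesgue_measure R \x m)%E (@tuple_cons n).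

Let cons_measure0 : cons_measure set0 = 0%E.
Proof. by rewrite /cons_measure /pushforward preimage_set0 measure0. Qed.

Let cons_measure_ge0 A : (0 <= cons_measure A)%E.
Proof. by rewrite /cons_measure /pushforward measure_ge0. Qed.

Let cons_measure_sigma_additive : semi_sigma_additive cons_measure.
Proof.
have mc F : measurable F -> measurable (@tuple_cons n @^-1` F).
  by move=> mF; rewrite -[X in measurable X]setTI; exact: measurable_tuple_cons.
move=> F mF tF mUF; rewrite /cons_measure /pushforward preimage_bigcup.
apply: measure_semi_sigma_additive.
- by move=> k; exact: mc.
- apply/trivIsetP => /= i j _ _ ij; rewrite -preimage_setI.
  by move/trivIsetP : tF => /(_ _ _ _ _ ij) ->//; rewrite preimage_set0.
- by rewrite -preimage_bigcup; exact: mc.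
Qed.

HB.instance Definition _ := isMeasure.Build _ _ _ cons_measure
  cons_measure0 cons_measure_ge0 cons_measure_sigma_additive.

Let cons_measure_sigma_finite : sigma_finite [set: _] cons_measure.
Proof.
have /sigma_finiteP[F [TF ndF Foo]] := sigma_finiteT (@lebesgue_measure R).
have /sigma_finiteP[G [TG ndG Goo]] := sigma_finiteT m.
exists (fun k => @tuple_uncons n @^-1` (F k `*` G k)).
  rewrite -preimage_bigcup (_ : \bigcup_k _ = setT) ?preimage_setT//.
  apply/seteqP; split=> // -[x t] _.
  have [i _ Fix] : (\bigcup_i F i) x by rewrite -TF.
  have [j _ Gjt] : (\bigcup_i G i) t by rewrite -TG.
  exists (maxn i j) => //; split=> /=.
    by move: x Fix; exact/subsetPset/ndF/leq_maxl.
  by move: t Gjt; exact/subsetPset/ndG/leq_maxr.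
move=> k; have [mF Fk] := Foo k; have [mG Gk] := Goo k; split.
  rewrite -[X in measurable X]setTI; apply: measurable_tuple_uncons => //.
  exact: measurableX.
rewrite /cons_measure /pushforward -comp_preimage.
rewrite (_ : _ \o _ = id); last first.
  by apply/funext => -[x t]; congr pair; exact/val_inj.
by rewrite preimage_id product_measure1E// lte_mul_pinfty// ge0_fin_numE.
Qed.

HB.instance Definition _ := Measure_isSigmaFinite.Build _ _ _ cons_measure
  cons_measure_sigma_finite.

End cons_measure.

Fixpoint lebesgue_tuple n : {sigma_finite_measure set (n.-tuple RR) -> \bar R} :=
  if n is n'.+1 then cons_measure (lebesgue_tuple n')
  else \d_([tuple] : 0.-tuple RR).

End lebesgue_tuple.

Section row_of_tuple.
Context {R : realType}.
Local Notation RR := (measurableTypeR R).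

Definition row_of_tuple d (x : d.-tuple RR) : 'rV[R]_d :=
  \row_(i < d) tnth x i.

Lemma row_of_tuple_ball_measurable d (v : 'rV[R]_d) (e : R) :
  measurable (@row_of_tuple d @^-1` ball v e).
Proof.
have [e0|e0] := ltP 0 e; last first.
  rewrite (_ : _ @^-1` _ = set0)// -subset0 => x [/= /lt_le_trans/(_ e0)].
  by rewrite ltxx.
rewrite (_ : _ @^-1` _ =
    \bigcap_i [set x : d.-tuple RR | ball (v 0 i) e (tnth x i)]).
  apply: fin_bigcap_measurable => [|i _]; first exact: finite_finset.
  rewrite -[X in measurable X]setTI; apply: (measurable_tnth i) => //=.
  by apply: open_measurable; exact: ball_open.
apply/seteqP; split=> x /=.
  by case=> _ b i _ /=; have := b 0 i; rewrite mxE.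
move=> b; split=> // i j; rewrite ord1 mxE.
exact: b.
Qed.

Lemma measurable_tuple_borel d :
  (measurable : set (set (d.-tuple RR))) =
  preimage_set_system setT (@row_of_tuple d) <<s (@open 'rV[R]_d) >>.
Proof.
apply/seteqP; split.
  rewrite -g_sigma_preimageE; apply: smallest_sub.
    exact: smallest_sigma_algebra.
  case: d => [|d]; first by rewrite big_ord0.
  rewrite -bigcup_mkord_ord => A [i /= id [B mB <-]].
  have mc : measurable_fun [set: g_sigma_algebraType (@open 'rV[R]_d.+1)]
      (fun v : 'rV[R]_d.+1 => v 0 (inord i) : RR).
    apply: (measurability _ (RGenOpens.measurableE R)) => _ [_ [a [b ->] <-]].
    apply: sub_sigma_algebra; rewrite setTI.
    apply: open_comp; last exact: interval_open.
    by move=> v _; exact: coord_continuous.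
  have mB' := mc measurableT B mB; rewrite g_sigma_preimageE.
  eexists; first exact: mB'.
  by rewrite !setTI; apply/seteqP; split=> x /=; rewrite /row_of_tuple mxE.
move=> _ [V mV <-].
suff mr : measurable_fun [set: d.-tuple RR]
    (@row_of_tuple d : _ -> g_sigma_algebraType (@open 'rV[R]_d)).
  exact: mr.
apply: (@measurability _ _ _ (g_sigma_algebraType (@open 'rV[R]_d)) setT
  (@row_of_tuple d) (@open 'rV[R]_d) erefl).
move=> _ [W oW <-].
rewrite setTI.
pose c (q : 'rV[rat]_d) : 'rV[R]_d := map_mx ratr q.
pose F (qk : 'rV[rat]_d * nat) : set 'rV[R]_d := ball (c qk.1) qk.2.+1%:R^-1.
have -> : W = \bigcup_(qk in [set qk | F qk `<=` W]) F qk.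
  apply/seteqP; split=> [v Wv|v [qk /= FW Fv]]; last exact: FW.
  have /nbhs_ballP[e /= e0 eW] : nbhs v W by exact: open_nbhs_nbhs.
  pose k := Num.truncn (2 / e).
  have k0 : 0 < k.+1%:R^-1 :> R by [].
  have ke : k.+1%:R^-1 < e / 2.
    rewrite -[ltRHS]invrK invf_div ltf_pV2 ?posrE ?divr_gt0//.
    exact: truncnS_gt.
  have /choice[q qv] i : exists q : rat, ball (v 0 i) k.+1%:R^-1 (ratr q : R).
    have [q] := @rat_in_itvoo R (v 0 i) (v 0 i + k.+1%:R^-1) (ltac:(by rewrite ltrDl)).
    rewrite in_itv/= => /andP[q1 q2]; exists q.
    by rewrite /ball/= distrC gtr0_norm ?subr_gt0// ltrBlDl.
  have bv : ball (c (\row_i q i)) k.+1%:R^-1 v.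
    by split=> // i j; rewrite !mxE ord1; apply: ball_sym.
  exists (\row_i q i, k) => //= w bw; apply: eW.
  rewrite [e]splitr; apply: (@ball_triangle _ _ (c (\row_i q i))).
    by apply: ball_sym; apply: le_ball bv; exact: ltW.
  by apply: le_ball bw; exact: ltW.
rewrite preimage_bigcup bigcup_mkcond.
apply: countable_bigcupT_measurable => [|qk]; first exact: countableP.
by case: ifP => // _; exact: row_of_tuple_ball_measurable.
Qed.

End row_of_tuple.

Section normal.
Context {R : realType}.
Local Notation RR := (measurableTypeR R).
Variables (d : nat) (mu : 'rV[R]_d) (S : 'M[R]_d).

(* Density of the normal distribution with mean mu and covariance matrix S,
   meaningful when S is positive definite; this holds for the positive
   multiples of [multinomial_cov p] when p is in the open simplex. *)
Definition mvnormal_pdf (x : d.-tuple RR) : R :=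
  let v := row_of_tuple x - mu in
  (Num.sqrt ((2 * pi) ^+ d * \det S))^-1 *
  expR (- (v *m invmx S *m v^T) 0 0 / 2).

Lemma mvnormal_pdf_ge0 x : 0 <= mvnormal_pdf x.
Proof. by rewrite mulr_ge0 ?expR_ge0// invr_ge0 sqrtr_ge0. Qed.

Lemma measurable_mvnormal_pdf : measurable_fun [set: _] mvnormal_pdf.
Proof.
apply: measurable_funM => //; apply: measurableT_comp => //.
apply: measurable_funM => //; apply: measurableT_comp => //.
have mv i : measurable_fun [set: d.-tuple RR]
    (fun x : d.-tuple RR => (row_of_tuple x - mu) 0 i).
  under eq_fun do rewrite !mxE.
  by apply: measurable_funB => //; exact: measurable_tnth.
under eq_fun do rewrite mxE.
apply: measurable_sum => j; under eq_fun do rewrite !mxE.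
apply: measurable_funM.
  by apply: measurable_sum => i; apply: measurable_funM.
by have := mv j; under eq_fun do rewrite !mxE.
Qed.

Definition mvnormal (U : set (d.-tuple RR)) : \bar R :=
  (\int[lebesgue_tuple d]_(x in U) (mvnormal_pdf x)%:E)%E.

Local Open Scope ereal_scope.

Let mvnormal0 : mvnormal set0 = 0.
Proof. exact: integral_set0. Qed.

Let mvnormal_ge0 U : 0 <= mvnormal U.
Proof. by apply: integral_ge0 => x _; rewrite lee_fin mvnormal_pdf_ge0. Qed.

Let mvnormal_sigma_additive : semi_sigma_additive mvnormal.
Proof.
move=> F mF tF mUF; rewrite /mvnormal ge0_integral_bigcup//.
- apply: is_cvg_ereal_nneg_natsum_cond => k _ _; exact: mvnormal_ge0.
- by apply/measurable_EFinP; apply: measurable_funTS measurable_mvnormal_pdf.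
- by move=> x _; rewrite lee_fin mvnormal_pdf_ge0.
Qed.

HB.instance Definition _ := isMeasure.Build _ _ _ mvnormal
  mvnormal0 mvnormal_ge0 mvnormal_sigma_additive.

End normal.

Definition multinomial_cov {R : realType} d (p : 'rV[R]_d) : 'M[R]_d :=
  diag_mx p - p^T *m p.

Section le_cam.
Context {R : realType}.
Local Open Scope ereal_scope.

(* Total variation of the signed set function nu over the whole space, without
   the factor 1/2: for probability measures,
   tv_norm (P - Q) = 2 sup_A `|P A - Q A|. *)
Definition tv_norm d (T : measurableType d) (nu : set T -> \bar R) : \bar R :=
  ereal_sup [set v | exists (m : nat) (A : 'I_m -> set T),
    [/\ forall i, measurable (A i), trivIset setT A,
        \bigcup_i A i = setT & v = \sum_(i < m) `|nu (A i)|]].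

Definition kernel_mix d1 d2 (X : measurableType d1) (Y : measurableType d2)
    (T : R.-pker X ~> Y) (P : {measure set X -> \bar R}) (U : set Y) : \bar R :=
  \int[P]_x T x U.

(* The supremum is taken in [0, +oo], so that it is 0 over an empty family. *)
Definition deficiency d1 d2 (X : measurableType d1) (Y : measurableType d2)
    (I : Type) (D : set I) (P : I -> {measure set X -> \bar R})
    (Q : I -> {measure set Y -> \bar R}) : \bar R :=
  ereal_inf [set ereal_sup (0 |`
      [set tv_norm (fun U => kernel_mix T (P p) U - Q p U) | p in D])
    | T in [set: R.-pker X ~> Y]].

Definition le_cam_distance d1 d2 (X : measurableType d1)
    (Y : measurableType d2) (I : Type) (D : set I)
    (P : I -> {measure set X -> \bar R}) (Q : I -> {measure set Y -> \bar R}) :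
    \bar R :=
  maxe (deficiency D P Q) (deficiency D Q P).

End le_cam.

(* Main.v *)
From HB Require Import structures.
Require Import Defs.
From mathcomp Require Import all_boot all_order all_algebra.
From mathcomp Require Import all_classical all_reals all_analysis.
From mathcomp Require Import measurable_realfun.
From mathcomp Require Import ring lra.

(** Let l i = n p_i for 1 <= i <= d + 1, let h be the hypergeometric mass
    function and let q be the density of Normal (n p, n Sigma_p). Up to its
    normalization q is the exponential of minus half of
    V (x) = sum_(i <= d+1) (x_i - l i)^2 / l i, where x_(d+1) = n - sum_i x_i.

    The kernel T_1 replaces k by a uniform point of the unit cube centred at k,
    and T_2 rounds a point of R^d to the centre of the cube that contains it.
    Rounding undoes smoothing, so that both deficiencies follow from one
    estimate, the comparison of T_1 P with the normal law Q on each event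
    (smoothed_hypergeometric_le); because both measures have mass 1, a one-sided
    comparison suffices (tv_norm_le_one_sided).

    This comparison is obtained from the relative entropy of T_1 P with respect
    to Q, through a pointwise form of Pinsker's inequality
    (le_add_relative_entropy, smoothed_le). The relative entropy is the
    expectation under h of ln h (k) - ln q averaged over the cube of k, and it
    is O (d^2 / n) for the following reason. Drawing without replacement
    multiplies the multinomial mass by at most exp (4 n^2 / N), and
    n^2 / N <= d^2 / n. In the multinomial mass each ln (k_i)! is bounded below
    by Stirling's formula and by the third order Taylor polynomial of
    y ln y - y at l i, which lies below the function (ln_fact_ge). After this
    step the logarithms cancel because sum_i k_i = sum_i l i = n, and the terms
    (k_i - l i)^2 / (2 l i) cancel against V exactly, before any expectation is
    taken (ln_hyper_weight_le). What remains is linear or cubic in k_i - l i.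
    The linear terms have mean 0, and the cubic ones have mean O (1 / l i) by
    the formula for the third moment (hyper_central3), hence d + 1 terms of
    order r d / n (hyper_relative_entropy_le, theta_entropy_le). The average of
    V over a cube adds the variance 1 / 12 per coordinate, which is again of
    that order (integral_cell_quadratic).

    That Q has mass 1 is proved by integrating out one coordinate at a time
    (integral_gauss_simplex), the moments of h come from coefficients of
    products of powers of 1 + X (sum_lattice_prod), and the constant in
    Stirling's formula from the Wallis integrals. *)

Import Order.TTheory GRing.Theory Num.Theory.
Import numFieldNormedType.Exports.
Local Open Scope classical_set_scope.
Local Open Scope ring_scope.
Set Implicit Arguments.
Unset Strict Implicit.
Unset Printing Implicit Defensive.

(** * Inequalities for the logarithm *)

Lemma le_derive_ge0 (R : realType) (f df : R -> R) (a b : R) :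
  (forall x : R, 0 < x -> is_derive x 1 f (df x)) ->
  0 < a -> a <= b -> (forall x, a <= x <= b -> 0 <= df x) -> f a <= f b.
Proof.
move=> fdf a0 ab df0.
have pos x : a <= x -> 0 < x by exact: lt_le_trans.
case: (eqVneq a b) => [->//|anb].
have altb : a < b by rewrite lt_neqAle anb.
have [||c] := @MVT _ f df a b altb.
- by move=> x; rewrite in_itv/= => /andP[ax _]; apply: fdf; apply: pos; exact: ltW.
- apply: derivable_within_continuous => x; rewrite in_itv/= => /andP[ax _].
  by have := fdf x (pos _ ax) => -[].
rewrite in_itv/= => /andP[ac cb] fab.
rewrite -subr_ge0 fab mulr_ge0 ?subr_ge0//.
by apply: df0; rewrite !ltW.
Qed.

Lemma is_derive_invr (R : realType) (x : R) : x != 0 ->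
  is_derive x 1 (fun y : R => y^-1) (- x ^- 2).
Proof.
move=> x0.
have ? : is_derive x 1 (fun y : R => y) (1:R) by exact: is_derive_id.
have := @is_deriveV R (fun y : R => y) x 1 1 x0.
by move=> h; apply: is_derive_eq; rewrite /GRing.scale/= mulr1.
Qed.

(** This bound and the next one both have an error of third order at t = 1.
    At t = (n + 1) / n the error is then O(1 / n^3), so that the increments of
    the Stirling sequence are O(1 / n^2) and can be summed. *)
Lemma ln_ge_pade (R : realType) (t : R) : 1 <= t -> 2 * (t - 1) / (t + 1) <= ln t.
Proof.
move=> t1.
pose f : R -> R := fun x : R => ln x + 4 * (x + 1)^-1.
pose df : R -> R := fun x => x^-1 - 4 * (x + 1) ^- 2.
have fdf (x : R) : 0 < x -> is_derive x 1 f (df x).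
  move=> x0; rewrite /f /df.
  have h1 := is_derive1_ln x0.
  have x1 : x + 1 != 0 by rewrite gt_eqF// addr_gt0.
  have h2 := @is_deriveV R (fun y : R => y + 1) x 1 1 x1.
  apply: is_derive_eq.
  rewrite /GRing.scale/=.
  by ring.
have := @le_derive_ge0 _ f df 1 t fdf ltr01 t1.
rewrite /f ln1 add0r; move=> H.
have {}H := H _.
have -> : 2 * (t - 1) / (t + 1) = 4 * (1 + 1)^-1 - 4 * (t+1)^-1.
  by field; rewrite gt_eqF//; lra.
rewrite lerBlDr; apply: H => x /andP[x1 _].
have x0 : 0 < x by lra.
have -> : df x = (x - 1) ^+ 2 / (x * (x + 1) ^+ 2).
  by rewrite /df; field; apply/andP; split; rewrite gt_eqF//; lra.
by rewrite divr_ge0 ?sqr_ge0// mulr_ge0 ?sqr_ge0// ltW.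
Qed.

Lemma ln_le_trapezoid (R : realType) (t : R) : 1 <= t -> ln t <= (t - t^-1) / 2.
Proof.
move=> t1.
pose f : R -> R := fun x : R => x - x^-1 - 2 * ln x.
pose df : R -> R := fun x => 1 + x ^- 2 - 2 * x^-1.
have fdf (x : R) : 0 < x -> is_derive x 1 f (df x).
  move=> x0; rewrite /f /df.
  have h1 := is_derive1_ln x0.
  have h2 := is_derive_invr (lt0r_neq0 x0).
  apply: is_derive_eq; rewrite /GRing.scale/=.
  by ring.
have := le_derive_ge0 fdf ltr01 t1.
rewrite /f ln1 invr1 => H.
have {}H := H _.
suff : 0 <= t - t^-1 - 2 * ln t by lra.
have -> : 0 = 1 - 1 - 2 * 0 :> R by ring.
apply: H => x /andP[x1 _].
have x0 : 0 < x by lra.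
have -> : df x = (1 - x^-1) ^+ 2.
  by rewrite /df; field; rewrite gt_eqF.
exact: sqr_ge0.
Qed.

(** The derivative of t ln t - t + 1 minus its third order Taylor polynomial
    at 1. *)
Definition taylor2 (R : realType) (t : R) := ln t - (t - 1) + (t - 1) ^+ 2 / 2.

Lemma ln_taylor2_incr (R : realType) (a b : R) : 0 < a -> a <= b ->
  taylor2 a <= taylor2 b.
Proof.
move=> a0 ab.
pose df : R -> R := fun x => x^-1 - 1 + (x - 1).
apply: (@le_derive_ge0 _ (@taylor2 R) df) => //.
  move=> x x0; rewrite /taylor2 /df.
  have h1 := is_derive1_ln x0.
  apply: is_derive_eq; rewrite /GRing.scale/=.
  by field; rewrite gt_eqF.
move=> x /andP[ax _]; have x0 : 0 < x by exact: lt_le_trans ax.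
have -> : df x = (x - 1) ^+ 2 / x.
  by rewrite /df; field; rewrite gt_eqF.
by rewrite divr_ge0 ?sqr_ge0// ltW.
Qed.

Lemma xlnx_ge_taylor3_at1 (R : realType) (t : R) : 0 < t ->
  - 1 + (t - 1) ^+ 2 / 2 - (t - 1) ^+ 3 / 6 <= t * ln t - t.
Proof.
move=> t0.
pose f : R -> R := fun x : R => x * ln x - x - (x - 1) ^+ 2 / 2 + (x - 1) ^+ 3 / 6.
have fdf (x : R) : 0 < x -> is_derive x 1 f (taylor2 x).
  move=> x0; rewrite /f /taylor2.
  have h1 := is_derive1_ln x0.
  apply: is_derive_eq; rewrite /GRing.scale/=.
  by field; rewrite gt_eqF.
have f1 : f 1 = - 1 by rewrite /f ln1; ring.
have T1 : taylor2 (1 : R) = 0 by rewrite /taylor2 ln1; ring.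
suff : f 1 <= f t by rewrite f1 /f; lra.
have [t1|t1] := leP 1 t.
  apply: (le_derive_ge0 fdf) => // x /andP[x1 _].
  by rewrite -T1; exact: ln_taylor2_incr.
rewrite -lerN2.
pose g := fun x => - f x.
have gdg (x : R) : 0 < x -> is_derive x 1 g (- taylor2 x).
  by move=> x0; have ? := fdf _ x0; apply: is_deriveN.
apply: (le_derive_ge0 gdg) => //; first exact: ltW.
move=> x /andP[tx x1]; rewrite oppr_ge0 -T1.
by apply: ln_taylor2_incr => //; exact: lt_le_trans tx.
Qed.

(** The fourth derivative of y ln y - y is 2 / y^3 > 0, so that the third
    order Taylor polynomial at any l > 0 is a lower bound on the whole
    half-line. This is why the relative entropy below is controlled by moments
    of order at most three. *)
Lemma xlnx_ge_taylor3 (R : realType) (l y : R) : 0 < l -> 0 < y ->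
  l * ln l - l + ln l * (y - l) + (y - l) ^+ 2 / (2 * l)
    - (y - l) ^+ 3 / (6 * l ^+ 2) <= y * ln y - y.
Proof.
move=> l0 y0.
have t0 : 0 < y / l by rewrite divr_gt0.
have := xlnx_ge_taylor3_at1 t0; rewrite -(ler_pM2l l0).
rewrite ln_div ?posrE//.
set lhs := (X in X <= _ -> _); set rhs := (X in _ <= X -> _) => h.
have -> : y * ln y - y = rhs + y * ln l.
  by rewrite /rhs; field; rewrite gt_eqF.
rewrite -lerBlDr.
apply: le_trans h; rewrite le_eqVlt; apply/orP; left; apply/eqP.
by rewrite /lhs; field; rewrite gt_eqF.
Qed.

(** * Wallis integrals and Stirling's formula *)

Lemma integral_FTC2 (R : realType) (f F : R -> R) (a b : R) : a < b ->
  continuous f -> (forall x : R, is_derive x 1 F (f x)) ->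
  (\int[lebesgue_measure]_(x in `[a, b]) (f x)%:E = (F b - F a)%:E)%E.
Proof.
move=> ab cf dF; rewrite EFinB.
have cF : continuous F.
  move=> x; apply: differentiable_continuous; apply/derivable1_diffP.
  exact: ex_derive.
apply: continuous_FTC2 => //.
- exact: continuous_subspaceT.
- split.
  + move=> x _; exact: ex_derive.
  + by apply: cvg_at_right_filter; exact: cF.
  + by apply: cvg_at_left_filter; exact: cF.
- by move=> x _; rewrite derive1E; exact: derive_val.
Qed.

Definition wallis (R : realType) (n : nat) : R :=
  \int[lebesgue_measure]_(x in `[0, pi / 2]) (sin x) ^+ n.

Lemma continuous_sinX (R : realType) n : continuous (fun x : R => sin x ^+ n).
Proof.
move=> x; apply: (@continuous_comp _ _ _ (@sin R) (fun y : R => y ^+ n)).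
  exact: continuous_sin.
exact: exprn_continuous.
Qed.

Lemma integrable_sinX (R : realType) n :
  lebesgue_measure.-integrable `[0, pi / 2] (fun x : R => (sin x ^+ n)%:E).
Proof.
apply: continuous_compact_integrable; first exact: segment_compact.
exact/continuous_subspaceT/continuous_sinX.
Qed.

Lemma pihalf_gt0 (R : realType) : 0 < pi / 2 :> R.
Proof. by rewrite divr_gt0// pi_gt0. Qed.

Lemma wallis0 (R : realType) : wallis R 0 = pi / 2.
Proof.
rewrite /wallis /Rintegral.
under eq_integral do rewrite expr0.
rewrite integral_cst//= mul1e lebesgue_measure_itv/= lte_fin pihalf_gt0.
by rewrite -EFinD subr0.
Qed.

Lemma wallis1 (R : realType) : wallis R 1 = 1.
Proof.
rewrite /wallis /Rintegral.
have dF (x : R) : is_derive x 1 (fun y : R => - cos y) (sin x ^+ 1).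
  by apply: is_derive_eq; rewrite opprK expr1.
rewrite (integral_FTC2 (pihalf_gt0 R) (@continuous_sinX R 1) dF).
by rewrite cos_pihalf cos0/=; ring.
Qed.

(** The difference of the two sides is the integral of the derivative of
    - cos x * sin x ^ n.+1, which vanishes at 0 and at pi / 2. *)
Lemma wallis_rec (R : realType) n :
  n.+2%:R * wallis R n.+2 = n.+1%:R * wallis R n.
Proof.
apply/eqP; rewrite -subr_eq0; apply/eqP.
have iZ m k : lebesgue_measure.-integrable `[0, pi / 2]
    (fun x : R => (m%:R * sin x ^+ k)%:E).
  by apply: (@integrableZl _ _ _ _ _ _ m%:R _ (integrable_sinX R k)).
have -> : n.+2%:R * wallis R n.+2 - n.+1%:R * wallis R n =
  \int[lebesgue_measure]_(x in `[0, pi / 2])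
    (n.+2%:R * sin x ^+ n.+2 - n.+1%:R * sin x ^+ n).
  rewrite /wallis -RintegralZl//; last exact: integrable_sinX.
  rewrite -RintegralZl//; last exact: integrable_sinX.
  by rewrite RintegralB//; exact: iZ.
rewrite /Rintegral.
have dF (x : R) : is_derive x 1 (fun y : R => - (cos y * sin y ^+ n.+1))
    (n.+2%:R * sin x ^+ n.+2 - n.+1%:R * sin x ^+ n).
  have h1 := is_derive_cos x; have h2 := is_derive_sin x.
  have h3 : is_derive x 1 (fun y : R => sin y ^+ n.+1)
      (n.+1%:R * sin x ^+ n * cos x).
    rewrite (_ : (fun y : R => _) = (@sin R) ^+ n.+1); last first.
      by apply/funext => y; rewrite exprfctE.
    exact: (is_derive_eq (is_deriveX n.+1 h2)).
  apply: (is_derive_eq (is_deriveN (is_deriveM h1 h3))).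
  rewrite /GRing.scale/=.
  have := cos2Dsin2 x => /(canRL (addrK _)) h.
  have -> : - (cos x * (n.+1%:R * sin x ^+ n * cos x) + sin x ^+ n.+1 * - sin x) =
    - (n.+1%:R * sin x ^+ n * cos x ^+ 2) + sin x ^+ n.+2.
    by rewrite !exprS; ring.
  by rewrite h -[n.+2%:R]natr1 !exprS; ring.
have cf : continuous (fun x : R => n.+2%:R * sin x ^+ n.+2 - n.+1%:R * sin x ^+ n).
  by move=> x; apply: (@cvgB _ R^o); apply: cvgMr; exact: continuous_sinX.
rewrite (integral_FTC2 (pihalf_gt0 R) cf dF).
by rewrite cos_pihalf cos0 sin0 expr0n/= mul0r mulr0 oppr0 subr0.
Qed.

Lemma wallis_le (R : realType) n : wallis R n.+1 <= wallis R n.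
Proof.
apply: le_Rintegral => //; try exact: integrable_sinX.
move=> x /= /itvP xI.
rewrite exprS ler_piMl ?sin_le1// exprn_ge0// sin_ge0_pi//.
rewrite xI/=; apply: le_trans (_ : pi / 2 <= pi); first by rewrite xI.
by have := pi_gt0 R; lra.
Qed.

(** 4^n divided by the central binomial coefficient. *)
Definition wallis_ratio (R : realType) (n : nat) : R :=
  4 ^+ n * n`!%:R ^+ 2 / (n.*2)`!%:R.

Lemma factR_gt0 (R : numDomainType) n : 0 < n`!%:R :> R.
Proof. by rewrite ltr0n fact_gt0. Qed.

Lemma wallis_ratio_gt0 (R : realType) n : 0 < wallis_ratio R n.
Proof. by rewrite divr_gt0 ?factR_gt0// mulr_gt0// exprn_gt0 ?factR_gt0. Qed.

Lemma wallis_ratioS (R : realType) n :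
  wallis_ratio R n.+1 = n.*2.+2%:R / n.*2.+1%:R * wallis_ratio R n.
Proof.
rewrite /wallis_ratio doubleS !factS !natrM exprS.
have n2 : (n.*2)%:R = 2 * n%:R :> R by rewrite -muln2 natrM mulrC.
rewrite -![in LHS]natr1 -![in RHS]natr1 n2.
have f0 := factR_gt0 R n; have g0 := factR_gt0 R n.*2.
have nn : 0 <= n%:R :> R by rewrite ler0n.
by field; repeat (apply/andP; split); rewrite gt_eqF//; lra.
Qed.

Lemma wallis_even (R : realType) n : wallis R n.*2 = pi / 2 / wallis_ratio R n.
Proof.
elim: n => [|n IH].
  by rewrite wallis0 /wallis_ratio/= fact0 expr0 expr1n mulr1 divr1 divr1.
have := wallis_rec R n.*2; rewrite IH -doubleS => h.
have a0 := wallis_ratio_gt0 R n.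
rewrite wallis_ratioS.
have -> : wallis R n.+1.*2 = n.*2.+1%:R * (pi / 2 / wallis_ratio R n) / n.*2.+2%:R.
  by rewrite -h doubleS mulrC mulKf// pnatr_eq0.
have nn : 0 <= n.*2%:R :> R by rewrite ler0n.
by field; repeat (apply/andP; split); rewrite gt_eqF//; lra.
Qed.

Lemma wallis_odd (R : realType) n :
  wallis R n.*2.+1 = wallis_ratio R n / n.*2.+1%:R.
Proof.
elim: n => [|n IH].
  by rewrite wallis1 /wallis_ratio/= fact0 expr0 expr1n mulr1 divr1 divr1.
have := wallis_rec R n.*2.+1; rewrite IH => h.
rewrite wallis_ratioS doubleS.
have -> : wallis R n.*2.+3 = n.*2.+2%:R * (wallis_ratio R n / n.*2.+1%:R) / n.*2.+3%:R.
  by rewrite -h mulrC mulKf// pnatr_eq0.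
have nn : 0 <= n.*2%:R :> R by rewrite ler0n.
by field; repeat (apply/andP; split); rewrite gt_eqF//; lra.
Qed.

(** The Wallis integrals decrease: their comparison at 2n + 2 and 2n + 1 gives
    the lower bound, that at 2n + 1 and 2n the upper bound. *)
Lemma wallis_ratio_ge (R : realType) n : (0 < n)%N ->
  pi * n%:R <= wallis_ratio R n ^+ 2.
Proof.
case: n => // n _.
have := wallis_le R n.*2.+1; rewrite -doubleS wallis_even wallis_odd.
have a0 := wallis_ratio_gt0 R n; have b0 := wallis_ratio_gt0 R n.+1.
have -> : wallis_ratio R n / n.*2.+1%:R = wallis_ratio R n.+1 / (2 * n.+1%:R).
  rewrite wallis_ratioS (_ : n.*2.+2%:R = 2 * n.+1%:R); last first.
    by rewrite -natrM mul2n.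
  have nn : 0 <= n%:R :> R by rewrite ler0n.
  have mm : 0 <= n.*2%:R :> R by rewrite ler0n.
  by field; repeat (apply/andP; split); rewrite gt_eqF//; lra.
by rewrite ler_pdivrMr// => h; move: h; rewrite mulrAC ler_pdivlMr ?mulr_gt0// expr2; lra.
Qed.

Lemma wallis_ratio_le (R : realType) n :
  wallis_ratio R n ^+ 2 <= pi * (n%:R + 2^-1).
Proof.
have := wallis_le R n.*2; rewrite wallis_even wallis_odd.
have a0 := wallis_ratio_gt0 R n.
rewrite ler_pdivrMr ?ltr0n// mulrAC ler_pdivlMr// -expr2 -[n.*2.+1%:R]natr1.
rewrite (_ : n.*2%:R = 2 * n%:R) => [h|]; last by rewrite -natrM mul2n.
by rewrite (_ : pi * _ = pi / 2 * (2 * n%:R + 1))//; field.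
Qed.

(** The logarithm of n! e^n / n^(n + 1/2), which decreases to ln (2 pi) / 2. *)
Definition stirling (R : realType) (n : nat) : R :=
  ln n`!%:R - (n%:R + 2^-1) * ln n%:R + n%:R.

Lemma stirling_step (R : realType) n : (0 < n)%N ->
  0 <= stirling R n - stirling R n.+1 <= (n%:R^-1 - n.+1%:R^-1) / 4.
Proof.
move=> n0; have nR : 0 < n%:R :> R by rewrite ltr0n.
have n1R : 0 < n.+1%:R :> R by rewrite ltr0n.
have t1 : 1 <= n.+1%:R / n%:R :> R by rewrite ler_pdivlMr// mul1r ler_nat.
have := ln_ge_pade t1; have := ln_le_trapezoid t1.
have -> : stirling R n - stirling R n.+1 =
    (n%:R + 2^-1) * ln (n.+1%:R / n%:R) - 1.
  rewrite /stirling ln_div ?posrE// factS natrM lnM ?posrE ?factR_gt0//.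
  by rewrite -[n.+1%:R]natr1; field.
set L := ln _; rewrite -[n.+1%:R]natr1 => u l.
have h0 : 0 < n%:R + 2^-1 :> R by lra.
move: u l; rewrite -(ler_pM2l h0) => u; rewrite -(ler_pM2l h0) => l.
apply/andP; split.
  rewrite subr_ge0; apply: le_trans l; rewrite le_eqVlt; apply/orP; left; apply/eqP.
  by field; repeat (apply/andP; split); rewrite gt_eqF//; lra.
rewrite lerBlDr; apply: (le_trans u); rewrite le_eqVlt; apply/orP; left; apply/eqP.
by field; repeat (apply/andP; split); rewrite gt_eqF//; lra.
Qed.

Lemma stirling_diff (R : realType) n k : (0 < n)%N ->
  0 <= stirling R n - stirling R (n + k)%N <= (n%:R^-1 - (n + k)%N%:R^-1) / 4.
Proof.
move=> n0; elim: k => [|k IH]; first by rewrite addn0 !subrr mul0r lexx.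
have := @stirling_step R (n + k); rewrite addn_gt0 n0/= => /(_ isT).
rewrite addnS; move: IH => /andP[a b] /andP[c d].
set y := (n + k).+1%:R^-1 in d *; set x := (n + k)%:R^-1 in b d.
by clearbody x y; apply/andP; split; lra.
Qed.

Lemma ln4 (R : realType) : ln 4 = 2 * ln 2 :> R.
Proof.
have two : (2 : R) \is Num.pos by rewrite posrE.
have := lnM two two; rewrite (_ : 2 * 2 = 4 :> R) => [->|]; last by ring.
by rewrite mulr2n mulrDl mul1r.
Qed.

Lemma wallis_ratio_stirling (R : realType) n : (0 < n)%N ->
  2 * stirling R n - stirling R n.*2 =
    (2 * ln (wallis_ratio R n) + ln 2 - ln n%:R) / 2.
Proof.
move=> n0; have nR : 0 < n%:R :> R by rewrite ltr0n.
have f0 := factR_gt0 R n; have g0 := factR_gt0 R n.*2.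
have e4 : (4 : R) ^+ n \is Num.pos by rewrite posrE exprn_gt0.
have ef : (n`!%:R : R) ^+ 2 \is Num.pos by rewrite posrE exprn_gt0.
have e4f : (4 : R) ^+ n * n`!%:R ^+ 2 \is Num.pos by rewrite posrE mulr_gt0.
have eg : ((n.*2)`!%:R : R) \is Num.pos by rewrite posrE.
have e2 : (2 : R) \is Num.pos by rewrite posrE.
have en : (n%:R : R) \is Num.pos by rewrite posrE.
have four : 0 < 4 :> R by [].
rewrite /wallis_ratio (ln_div e4f eg) (lnM e4 ef) (lnXn n four) (lnXn 2 f0) ln4.
rewrite /stirling.
have -> : n.*2%:R = 2 * n%:R :> R by rewrite -natrM mul2n.
rewrite (lnM e2 en) -(mulr_natr (2 * ln 2)) -(mulr_natr (ln n`!%:R)).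
move: (ln n`!%:R) (ln (n.*2)`!%:R) (ln 2) (ln n%:R) => A B D E.
by field.
Qed.

(** In 2 s(n) - s(2n) the factorials combine into the Wallis ratio, and this
    is what identifies the limit of s = stirling as ln (2 pi) / 2. *)
Lemma stirling_double (R : realType) n : (0 < n)%N ->
  ln (2 * pi) / 2 <= 2 * stirling R n - stirling R n.*2
                  <= ln (2 * pi) / 2 + (4 * n%:R)^-1.
Proof.
move=> n0; have nR : 0 < n%:R :> R by rewrite ltr0n.
have w0 := wallis_ratio_gt0 R n.
have pi0 := pi_gt0 R.
have := wallis_ratio_ge R n0; have := wallis_ratio_le R n.
rewrite wallis_ratio_stirling//.
move: (wallis_ratio R n) (pi : R) w0 pi0 => w p w0 pi0 wle wge.
have lb : ln p + ln n%:R <= 2 * ln w.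
  rewrite mulr_natl -lnXn// -lnM ?posrE// ler_ln ?posrE ?mulr_gt0 ?exprn_gt0//.
have ub : 2 * ln w <= ln p + ln n%:R + (2 * n%:R)^-1.
  have i0 : 0 < (2 * n%:R)^-1 :> R by rewrite invr_gt0 mulr_gt0.
  rewrite mulr_natl -lnXn//.
  apply: (@le_trans _ _ (ln (p * n%:R * (1 + (2 * n%:R)^-1)))).
    rewrite ler_ln ?posrE ?mulr_gt0 ?exprn_gt0 ?addr_gt0//.
    apply: (le_trans wle); rewrite le_eqVlt; apply/orP; left; apply/eqP; field.
    by rewrite gt_eqF.
  have p1 : p * n%:R \is @Num.pos R by exact: mulr_gt0.
  have p2 : 1 + (2 * n%:R)^-1 \is @Num.pos R by rewrite posrE addr_gt0.
  have p3 : p \is @Num.pos R by rewrite posrE.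
  have p4 : n%:R \is @Num.pos R by rewrite posrE.
  rewrite lnM// lnM// lerD2l.
  by apply: le_ln1Dx; exact: lt_trans i0.
have -> : ln (2 * p) = ln 2 + ln p :> R by rewrite lnM ?posrE.
have -> : (4 * n%:R)^-1 = (2 * n%:R)^-1 / 2 :> R by field; rewrite gt_eqF.
apply/andP; split; lra.
Qed.

(** The sequence decreases, so that a value below ln (2 pi) / 2 would stay away
    from it, whereas stirling_double and stirling_diff leave a gap of at most
    1 / (8 m) at rank m. *)
Lemma stirling_ge (R : realType) n : (0 < n)%N -> ln (2 * pi) / 2 <= stirling R n.
Proof.
move=> n0; rewrite leNgt; apply/negP => lt.
pose e := ln (2 * pi) / 2 - stirling R n; have e0 : 0 < e by rewrite subr_gt0.
(* stirling m >= ln (2 pi)/2 - 1/(8m) for every m *)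
pose m := (n + Num.truncn (e^-1))%N.
have m0 : (0 < m)%N by rewrite addn_gt0 n0.
have mR : 0 < m%:R :> R by rewrite ltr0n.
have /andP[h1 _] := stirling_double R m0.
have /andP[_ h2] := @stirling_diff R m m m0.
have /andP[h3 _] := @stirling_diff R n (Num.truncn (e^-1)) n0.
have h4 : m%:R^-1 < e.
  rewrite invf_plt ?posrE//; apply: lt_le_trans (truncnS_gt _) _.
  by rewrite ler_nat /m -addn1 addnC leq_add2r.
rewrite addnn in h2; rewrite -/m in h3.
have : (m.*2)%:R^-1 > 0 :> R by rewrite invr_gt0 ltr0n double_gt0.
rewrite /e in h4 *; lra.
Qed.

(** s(n) = (2 s(n) - s(2n)) - (s(n) - s(2n)), and s decreases. *)
Lemma stirling_le (R : realType) n : (0 < n)%N ->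
  stirling R n <= ln (2 * pi) / 2 + (4 * n%:R)^-1.
Proof.
move=> n0; have /andP[_ h1] := stirling_double R n0.
by have /andP[h2 _] := @stirling_diff R n n n0; rewrite addnn in h2; lra.
Qed.

Lemma ln_le_tangent (R : realType) (l y : R) : 0 < l -> 0 < y ->
  ln y <= ln l + (y - l) / l.
Proof.
move=> l0 y0; rewrite -lerBlDl -ln_div ?posrE//.
have -> : y / l = 1 + (y - l) / l by field; rewrite gt_eqF.
apply: le_ln1Dx; rewrite -subr_gt0.
have -> : (y - l) / l - -1 = y / l by field; rewrite gt_eqF.
by rewrite divr_gt0.
Qed.

Lemma ln_fact_le (R : realType) n : (0 < n)%N ->
  ln n`!%:R <= (n%:R + 2^-1) * ln n%:R - n%:R + ln (2 * pi) / 2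
               + (4 * n%:R)^-1 :> R.
Proof.
move=> n0; have := stirling_le R n0; rewrite /stirling.
move: (ln n`!%:R) (ln (2 * pi)) => A B; lra.
Qed.

(** Stirling's lower bound is applied to (k + 1)! = (k + 1) k!, which covers
    k = 0. The right choice of l is the mean of a random k: the term
    (k - l)^2 / (2 l) is then exactly the one in the Gaussian exponent, the
    terms linear in k - l average out, and the cubic one is of order 1 / l. *)
Lemma ln_fact_ge (R : realType) (l : R) k : 0 < l ->
  ln (2 * pi) / 2 + (l + 2^-1) * ln l - l + (k%:R - l) * ln l
    + (k%:R - l) ^+ 2 / (2 * l) + (k%:R - l) / (2 * l)
    - (k%:R - l + 1) ^+ 3 / (6 * l ^+ 2) <= ln k`!%:R.
Proof.
move=> l0; have := @stirling_ge R k.+1 isT; rewrite /stirling.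
have y0 : 0 < k.+1%:R :> R by rewrite ltr0n.
have -> : ln k.+1`!%:R = ln k.+1%:R + ln k`!%:R :> R.
  by rewrite factS natrM lnM ?posrE// ltr0n fact_gt0.
have := ln_le_tangent l0 y0; have := xlnx_ge_taylor3 l0 y0.
move: (ln k`!%:R) (ln (2 * pi)) => A B.
have -> : k.+1%:R = k%:R + 1 :> R by rewrite natr1.
move: (k%:R : R) => x.
move: (ln (x + 1)) (ln l) => Y L.
have -> : (x + 1 - l) / l = 2 * ((x - l) / (2 * l)) + 2 * (2 * l)^-1.
  by field; rewrite gt_eqF.
have -> : (x + 1 - l) ^+ 2 / (2 * l) =
    (x - l) ^+ 2 / (2 * l) + 2 * ((x - l) / (2 * l)) + (2 * l)^-1.
  by field; rewrite gt_eqF.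
have -> : x + 1 - l = x - l + 1 by ring.
move: ((x - l) ^+ 2 / (2 * l)) ((x - l) / (2 * l)) ((2 * l)^-1) (_ ^+ 3 / _) => a b c e.
nra.
Qed.

(** * Sums over the lattice simplex *)

Lemma lattice_barycentric_max d n (k : lattice_simplex d n) :
  lattice_barycentric k ord_max = (n - \sum_(j < d) val k j)%N.
Proof. by rewrite /lattice_barycentric unlift_none. Qed.

Lemma lattice_barycentric_widen d n (k : lattice_simplex d n) (j : 'I_d) :
  lattice_barycentric k (widen_ord (leqnSn d) j) = val k j.
Proof.
rewrite (_ : widen_ord _ j = lift ord_max j); last first.
  by apply/val_inj; rewrite /= /bump leqNgt ltn_ord.
by rewrite /lattice_barycentric liftK.
Qed.

Lemma sum_lattice_barycentric d n (k : lattice_simplex d n) :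
  (\sum_(i < d.+1) lattice_barycentric k i = n)%N.
Proof.
rewrite big_ord_recr/= lattice_barycentric_max.
under eq_bigr do rewrite lattice_barycentric_widen.
by rewrite subnKC//; case: k.
Qed.

Lemma lattice_barycentric_le d n (k : lattice_simplex d n) i :
  (lattice_barycentric k i <= n)%N.
Proof.
by rewrite -[leqRHS](sum_lattice_barycentric k) (bigD1 i)//= leq_addr.
Qed.

(** The coefficients of a product up to degree n only see the factors up to
    degree n, so that polynomials can be truncated there. *)
Lemma coef_prod_eq (R : comNzRingType) (I : Type) (s : seq I) (P Q : I -> {poly R}) n :
  (forall i m, (m <= n)%N -> (P i)`_m = (Q i)`_m) ->
  (\prod_(i <- s) P i)`_n = (\prod_(i <- s) Q i)`_n.
Proof.
move=> PQ; suff : forall m, (m <= n)%N ->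
  (\prod_(i <- s) P i)`_m = (\prod_(i <- s) Q i)`_m by exact.
elim: s => [|i s IH] m mn; first by rewrite !big_nil.
rewrite !big_cons !coefM; apply: eq_bigr => j _; rewrite PQ; last first.
  by apply: leq_trans mn; rewrite -ltnS.
by rewrite IH//; apply: leq_trans mn; exact: leq_subr.
Qed.

Lemma coef_prod_ffun (R : comNzRingType) (I : finType) (P : I -> {poly R}) n :
  (\prod_i P i)`_n =
  \sum_(f : {ffun I -> 'I_n.+1} | (\sum_i f i)%N == n) \prod_i (P i)`_(f i).
Proof.
rewrite (@coef_prod_eq _ _ _ _ (fun i => \sum_(j < n.+1) (P i)`_j *: 'X^j)); last first.
  by move=> i m mn; rewrite -poly_def coef_poly ltnS mn.
rewrite bigA_distr_bigA/= coef_sum [RHS]big_mkcond/=; apply: eq_bigr => f _.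
rewrite scaler_prod coefZ.
have -> : \prod_i 'X^(f i) = 'X^(\sum_i f i)%N :> {poly R}.
  by rewrite (big_morph _ (@exprD _ 'X) (expr0 _)).
by rewrite coefXn eq_sym; case: ifP; rewrite ?mulr1 ?mulr0.
Qed.

(** A sum of products over the lattice simplex is a coefficient of a product of
    d + 1 polynomials; all the Vandermonde identities below come from here. *)
Lemma sum_lattice_prod (R : comNzRingType) d n (P : 'I_d.+1 -> {poly R}) :
  \sum_(k : lattice_simplex d n) \prod_i (P i)`_(lattice_barycentric k i)
  = (\prod_i P i)`_n.
Proof.
rewrite coef_prod_ffun.
pose h (k : lattice_simplex d n) : {ffun 'I_d.+1 -> 'I_n.+1} :=
  [ffun i => inord (lattice_barycentric k i)].
pose g (f : {ffun 'I_d.+1 -> 'I_n.+1}) : lattice_simplex d n :=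
  insubd (point : lattice_simplex d n) [ffun j => f (widen_ord (leqnSn d) j)].
have hE k i : h k i = lattice_barycentric k i :> nat.
  by rewrite ffunE inordK// ltnS lattice_barycentric_le.
rewrite (reindex_onto h g)/=; last first.
  move=> f /eqP fn.
  have le : (\sum_(i < d) [ffun j => f (widen_ord (leqnSn d) j)] i <= n)%N.
    rewrite -[leqRHS]fn big_ord_recr/=.
    by under eq_bigr do rewrite ffunE; exact: leq_addr.
  have vg : val (g f) = [ffun j => f (widen_ord (leqnSn d) j)].
    by rewrite /g val_insubd le.
  apply/ffunP => i; apply/val_inj; rewrite /= hE.
  case: (unliftP ord_max i) => [j ->|->].
    have -> : lift ord_max j = widen_ord (leqnSn d) j.
      by apply/val_inj; rewrite /= /bump leqNgt ltn_ord.
    by rewrite lattice_barycentric_widen vg ffunE.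
  rewrite lattice_barycentric_max vg -[X in (X - _)%N]fn big_ord_recr/=.
  by under [in X in (_ - X)%N]eq_bigr do rewrite ffunE; rewrite addKn.
apply: eq_big => [k|k _].
  apply/esym/andP; split.
    by under eq_bigr do rewrite hE; rewrite sum_lattice_barycentric.
  apply/eqP/val_inj; rewrite /g val_insubd.
  have -> : [ffun j => h k (widen_ord (leqnSn d) j)] = val k.
    apply/ffunP => j; apply/val_inj; rewrite /= ffunE hE.
    by rewrite lattice_barycentric_widen.
  by case: k => /= k ->.
by apply: eq_bigr => i _; rewrite hE.
Qed.

(** * Moments of the hypergeometric distribution *)

Lemma ffact_bin j m r : (r <= j)%N ->
  (j ^_ r * 'C(m, j) = m ^_ r * 'C(m - r, j - r))%N.
Proof.
elim: r => [|r IH] rj; first by rewrite !ffactn0 !subn0.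
rewrite !ffactnSr mulnAC IH ?(ltnW rj)// -!mulnA; congr (_ * _)%N.
have -> : (j - r = (j - r.+1).+1)%N by rewrite -subSn// subSS.
by rewrite mulnC -mul_bin_diag [(m - r.+1)%N]subnS.
Qed.

Lemma coef_1DX_exp (R : comNzRingType) m j : ((1 + 'X) ^+ m : {poly R})`_j = 'C(m, j)%:R.
Proof.
rewrite addrC exprDn coef_sum.
under eq_bigr do rewrite expr1n mulr1 coefMn coefXn.
have [jm|mj] := leqP j m.
  rewrite (bigD1 (Ordinal (leq_ltn_trans (leq_subr j m) (ltnSn m))))//=.
  rewrite subKn// eqxx bin_sub// big1 ?addr0// => i /eqP ij.
  rewrite (_ : (j == m - i)%N = false) ?mul0rn//; apply/negbTE/eqP => ji.
  by apply: ij; apply/val_inj; rewrite /= ji subKn// -ltnS.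
rewrite bin_small// big1// => i _.
by rewrite gtn_eqF ?mul0rn//; apply: leq_ltn_trans mj; exact: leq_subr.
Qed.

(** As j ^_ r * 'C(m, j) = m ^_ r * 'C(m - r, j - r), a factorial moment
    amounts to replacing (1 + X)^m by m ^_ r X^r (1 + X)^(m - r) in the
    generating polynomial of the class i0. *)
Lemma vandermonde_ffact (R : comNzRingType) d n (M : 'I_d.+1 -> nat) i0 r :
  (r <= n)%N ->
  \sum_(k : lattice_simplex d n)
     (lattice_barycentric k i0 ^_ r)%:R * \prod_i 'C(M i, lattice_barycentric k i)%:R
  = ((M i0) ^_ r * 'C(\sum_i M i - r, n - r))%N%:R :> R.
Proof.
move=> rn.
pose P i : {poly R} := if i == i0 then ((M i0) ^_ r)%:R *: ('X^r * (1 + 'X) ^+ (M i0 - r))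
  else (1 + 'X) ^+ (M i).
transitivity (\sum_(k : lattice_simplex d n) \prod_i (P i)`_(lattice_barycentric k i)).
  apply: eq_bigr => k _; rewrite (bigD1 i0)//= [RHS](bigD1 i0)//= mulrA.
  congr (_ * _); last first.
    by apply: eq_bigr => i /negbTE ii; rewrite /P ii coef_1DX_exp.
  rewrite /P eqxx coefZ coefXnM -natrM; case: ltnP => [lt|le].
    by rewrite ffact_small// mulr0.
  by rewrite ffact_bin// coef_1DX_exp natrM.
rewrite sum_lattice_prod natrM.
have -> : \prod_i P i = ((M i0) ^_ r)%:R *: ('X^r * (1 + 'X) ^+ (M i0 - r + \sum_(i | i != i0) M i)).
  rewrite (bigD1 i0)//= {1}/P eqxx -scalerAl -mulrA exprD; congr (_ *: (_ * (_ * _))).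
  under eq_bigr => i /negbTE ii do rewrite /P ii.
  by rewrite -expr_sum.
rewrite coefZ coefXnM ltnNge rn/= coef_1DX_exp.
have [le|lt] := leqP r (M i0); last by rewrite ffact_small// !mul0r.
by rewrite [in RHS](bigD1 i0)//= addnBAC.
Qed.

(** The hypergeometric mass in terms of the integer class sizes M i = N p_i. *)
Definition hyper_weight (R : realType) d n (M : 'I_d.+1 -> nat)
    (k : lattice_simplex d n) : R :=
  (\prod_i 'C(M i, lattice_barycentric k i))%:R / 'C(\sum_i M i, n)%:R.

Lemma hyper_weight_ge0 (R : realType) d n (M : 'I_d.+1 -> nat)
  (k : lattice_simplex d n) : 0 <= hyper_weight R M k.
Proof. by rewrite divr_ge0. Qed.

Section hyper_moments.
Variables (R : realType) (d n : nat) (M : 'I_d.+1 -> nat).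
Let N := (\sum_i M i)%N.
Hypothesis nN : (n <= N)%N.

Let C0 : 'C(N, n)%:R != 0 :> R.
Proof. by rewrite pnatr_eq0 -lt0n bin_gt0. Qed.

Lemma hyper_ffact_moment i r :
  (\sum_(k : lattice_simplex d n)
    hyper_weight R M k * (lattice_barycentric k i ^_ r)%:R) * (N ^_ r)%:R
  = (n ^_ r * (M i) ^_ r)%N%:R.
Proof.
have [rn|nr] := leqP r n; last first.
  rewrite [n ^_ r]ffact_small// mul0n big1 ?mul0r// => k _.
  by rewrite ffact_small ?mulr0// (leq_ltn_trans (lattice_barycentric_le k i)).
transitivity ((\sum_(k : lattice_simplex d n)
     (lattice_barycentric k i ^_ r)%:R * \prod_i 'C(M i, lattice_barycentric k i)%:R)
     / 'C(N, n)%:R * (N ^_ r)%:R : R).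
  congr (_ * _); rewrite mulr_suml; apply: eq_bigr => k _.
  by rewrite /hyper_weight natr_prod mulrAC; congr (_ / _); exact: mulrC.
rewrite vandermonde_ffact// -/N mulrAC -natrM -mulnA.
rewrite [X in (_ * X)%N]mulnC -ffact_bin// mulnA natrM mulfK//.
by rewrite mulnC.
Qed.

Lemma hyper_sum1 : \sum_(k : lattice_simplex d n) hyper_weight R M k = 1.
Proof.
have := @hyper_ffact_moment ord0 0; rewrite !ffactn0 mulr1 muln1 => h; rewrite -[RHS]/(1%:R) -h.
by apply: eq_bigr => k _; rewrite ffactn0 mulr1.
Qed.

Section central.
Hypotheses (n0 : (0 < n)%N) (ltnN : (n < N)%N) (N2 : (2 < N)%N).
Variable i : 'I_d.+1.
Let l : R := n%:R * (M i)%:R / N%:R.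
Let NR : R := N%:R.
Let NR2 : 2 < NR. Proof. by rewrite ltr_nat. Qed.
Local Notation x k := ((lattice_barycentric k i)%:R : R).

Lemma natr_ffactS (m r : nat) : (m ^_ r.+1)%:R = (m ^_ r)%:R * (m%:R - r%:R) :> R.
Proof.
rewrite ffactnSr natrM; have [rm|mr] := leqP r m; first by rewrite natrB.
by rewrite ffact_small// !mul0r.
Qed.

Let ff (m : nat) :
  ((m ^_ 1)%:R = m%:R :> R) * ((m ^_ 2)%:R = m%:R * (m%:R - 1) :> R) *
  ((m ^_ 3)%:R = m%:R * (m%:R - 1) * (m%:R - 2) :> R).
Proof. by rewrite !natr_ffactS !ffactn0 subr0 mul1r. Qed.

Lemma hyper_mean : \sum_(k : lattice_simplex d n) hyper_weight R M k * x k = l.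
Proof.
have := hyper_ffact_moment i 1; rewrite [(n ^_ 1 * _)%:R]natrM !ff -/NR => h.
rewrite /l -h mulfK ?gt_eqF//; last exact: lt_trans NR2.
by apply: eq_bigr => k _; rewrite ff.
Qed.

(** With q = M i / N the third central moment is
    l (1 - q) (1 - 2q) (N - n) (N - 2n) / ((N - 1) (N - 2)) and the variance is
    l (1 - q) (N - n) / (N - 1); both are at most l because the ratios
    (N - n) / (N - 1) and (N - 2n) / (N - 2) are at most 1 in absolute value. *)
Lemma hyper_central3 : \sum_(k : lattice_simplex d n) hyper_weight R M k * (x k - l + 1) ^+ 3 <= 4 * l + 1.
Proof.
have h1 := hyper_mean.
have := hyper_ffact_moment i 2; have := hyper_ffact_moment i 3.
rewrite [(n ^_ 2 * _)%:R]natrM [(n ^_ 3 * _)%:R]natrM !ff -/NR.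
set E3 := \sum_k _; set E2 := \sum_k _ => h3 h2.
pose c1 := 1 + 3 * (1 - l) + 3 * (1 - l) ^+ 2; pose c0 := (1 - l) ^+ 3.
have -> : \sum_(k : lattice_simplex d n) hyper_weight R M k * (x k - l + 1) ^+ 3 =
    E3 + (6 - 3 * l) * E2 + c1 * l + c0.
  transitivity (E3 + (6 - 3 * l) * E2 +
      c1 * (\sum_(k : lattice_simplex d n) hyper_weight R M k * x k) + c0 * \sum_(k : lattice_simplex d n) hyper_weight R M k).
    rewrite /E3 /E2 !mulr_sumr -!big_split/=; apply: eq_bigr => k _.
    by rewrite !ff /c1 /c0; ring.
  by rewrite h1 hyper_sum1 mulr1.
rewrite /c1 /c0 {c1 c0}.
have N0 : 0 < NR by exact: lt_trans NR2.
have N1 : 0 < NR - 1 by rewrite subr_gt0; apply: lt_trans NR2; rewrite ltrDl.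
have N2' : 0 < NR - 2 by rewrite subr_gt0.
have Mi0 : 0 <= (M i)%:R :> R by rewrite ler0n.
have MiN : (M i)%:R <= NR.
  by rewrite ler_nat /N (bigD1 i)//= leq_addr.
have nR : 1 <= n%:R :> R by rewrite ler1n.
have nNR : n%:R <= NR - 1.
  by rewrite lerBrDr natr1 ler_nat.
have E2E : E2 = n%:R * (n%:R - 1) * ((M i)%:R * ((M i)%:R - 1)) / (NR * (NR - 1)).
  by rewrite -h2 mulfK// mulf_neq0 ?gt_eqF.
have E3E : E3 = n%:R * (n%:R - 1) * (n%:R - 2) *
   ((M i)%:R * ((M i)%:R - 1) * ((M i)%:R - 2)) / (NR * (NR - 1) * (NR - 2)).
  by rewrite -h3 mulfK// !mulf_neq0 ?gt_eqF.
rewrite E2E E3E /l -/NR; move: NR N0 N1 N2' ((M i)%:R : R) (n%:R : R) Mi0 MiN nR nNR.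
move=> {E3E E2E h3 h2 E2 E3 h1}.
move=> N' N0 N1 N2' m a m0 mN a1 aN.
set p := m / N'.
have p0 : 0 <= p by rewrite divr_ge0// ltW.
have p1 : p <= 1 by rewrite ler_pdivrMr// mul1r.
set u := (N' - a) / (N' - 1); set v := (N' - a * 2) / (N' - 2).
set L := a * m / N'.
have L0 : 0 <= L by rewrite divr_ge0// ?mulr_ge0// ?ltW//; lra.
have u0 : 0 <= u by rewrite divr_ge0//; lra.
have u1 : u <= 1 by rewrite ler_pdivrMr// mul1r; lra.
have v1 : `|v| <= 1.
  rewrite /v normrM [`|_^-1|]gtr0_norm ?invr_gt0// ler_pdivrMr// mul1r ler_norml.
  by apply/andP; split; lra.
have p2 : `|1 - 2 * p| <= 1 by rewrite ler_norml; apply/andP; split; lra.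
have -> : a * (a - 1) * (a - 2) * (m * (m - 1) * (m - 2)) / (N' * (N' - 1) * (N' - 2)) +
  (6 - 3 * L) * (a * (a - 1) * (m * (m - 1)) / (N' * (N' - 1))) +
  (1 + 3 * (1 - L) + 3 * (1 - L) ^+ 2) * L + (1 - L) ^+ 3 =
  L * ((1 - p) * u) * ((1 - 2 * p) * v) + 3 * (L * ((1 - p) * u)) + 1.
  by rewrite /L /p /u /v; field; repeat (apply/andP; split); rewrite gt_eqF.
have w1 : (1 - p) * u <= 1 by apply: mulr_ile1 => //; lra.
have w0 : 0 <= (1 - p) * u by rewrite mulr_ge0//; lra.
have z1 : (1 - 2 * p) * v <= 1.
  by apply: le_trans (ler_norm _) _; rewrite normrM mulr_ile1.
have LL : L * ((1 - p) * u) <= L by rewrite ler_piMr.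
have LL0 : 0 <= L * ((1 - p) * u) by rewrite mulr_ge0.
have : L * ((1 - p) * u) * ((1 - 2 * p) * v) <= L * ((1 - p) * u) by rewrite ler_piMr.
lra.
Qed.

End central.
End hyper_moments.

(** * The logarithm of the hypergeometric mass *)

Lemma bin_fact_le_expn m k : ('C(m, k) * k`! <= m ^ k)%N.
Proof.
rewrite bin_ffact; elim: k => [|k IH]; first by rewrite ffactn0 expn0.
by rewrite ffactnSr expnSr leq_mul// leq_subr.
Qed.

(** Every factor N / (N - m) with m < n is at most 1 + 4n / N, because
    N - m >= N / 4. *)
Lemma exp_le_expR_ffact (R : realType) (N n : nat) : (0 < N)%N ->
  n%:R <= 3 / 4 * N%:R :> R ->
  N%:R ^+ n <= expR (4 * n%:R ^+ 2 / N%:R) * (N ^_ n)%:R :> R.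
Proof.
move=> N0 nN; have NR : 0 < N%:R :> R by rewrite ltr0n.
have -> : 4 * n%:R ^+ 2 / N%:R = n%:R * (4 * n%:R / N%:R) :> R.
  by field; rewrite gt_eqF.
rewrite expRM_natl.
have : forall m, (m <= n)%N ->
  N%:R ^+ m <= expR (4 * n%:R / N%:R) ^+ m * (N ^_ m)%:R :> R.
  elim=> [|m IH] mn; first by rewrite !expr0 ffactn0 mulr1.
  rewrite natr_ffactS !exprSr mulrACA.
  apply: ler_pM; [by rewrite exprn_ge0 ?ltW|exact: ltW|exact: IH (ltnW mn)|].
  have mR : m%:R <= n%:R :> R by rewrite ler_nat ltnW.
  have Nm : 0 < N%:R - m%:R :> R by lra.
  rewrite -ler_pdivrMr//; apply: le_trans (expR_ge1Dx _).
  rewrite -lerBlDl (_ : _ - 1 = m%:R / (N%:R - m%:R)); last first.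
    by field; rewrite gt_eqF.
  rewrite ler_pdivrMr// mulrAC ler_pdivlMr//.
  have m0 : 0 <= m%:R :> R by rewrite ler0n.
  apply: (@le_trans _ _ (n%:R * N%:R)); first by apply: ler_wpM2r => //; exact: ltW.
  rewrite -mulrA mulrCA ler_wpM2l//; lra.
exact.
Qed.

Section log_bound.
Variables (R : realType) (d n : nat) (M : 'I_d.+1 -> nat).
Let N := (\sum_i M i)%N.
Hypotheses (n0 : (0 < n)%N) (N0 : (0 < N)%N) (M0 : forall i, (0 < M i)%N).
Hypothesis nN : n%:R <= 3 / 4 * N%:R :> R.

Let NR : 0 < N%:R :> R. Proof. by rewrite ltr0n. Qed.
Let nR : 0 < n%:R :> R. Proof. by rewrite ltr0n. Qed.

Definition hyper_mean_at (i : 'I_d.+1) : R := n%:R * (M i)%:R / N%:R.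
Local Notation l := hyper_mean_at.
Local Notation dev k i := ((lattice_barycentric k i)%:R - l i).

Lemma hyper_mean_at_gt0 i : 0 < l i.
Proof. by rewrite divr_gt0// mulr_gt0 ?ltr0n. Qed.

Lemma sum_hyper_mean_at : \sum_i l i = n%:R.
Proof. by rewrite -mulr_suml -mulr_sumr -natr_sum -/N mulfK// gt_eqF. Qed.

(** Drawing without replacement costs at most the factor exp (4 n^2 / N) with
    respect to the multinomial mass, which is the right-hand side otherwise. *)
Lemma hyper_weight_le (k : lattice_simplex d n) :
  hyper_weight R M k <= expR (4 * n%:R ^+ 2 / N%:R) * n`!%:R *
    \prod_i (((M i)%:R / N%:R) ^+ lattice_barycentric k i / (lattice_barycentric k i)`!%:R).
Proof.
have f0 m : 0 < m`!%:R :> R by exact: factR_gt0.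
have nN' : (n <= N)%N by rewrite -(ler_nat R); apply: (le_trans nN); rewrite ler_piMl ?ltW//; lra.
have C0 : 0 < 'C(N, n)%:R :> R by rewrite ltr0n bin_gt0.
rewrite /hyper_weight -/N ler_pdivrMr// natr_prod.
apply: (@le_trans _ _ (\prod_i ((M i)%:R ^+ lattice_barycentric k i / (lattice_barycentric k i)`!%:R))).
  apply: ler_prod => i _; rewrite ler0n/= ler_pdivlMr// -natrX -natrM ler_nat.
  exact: bin_fact_le_expn.
have -> : \prod_i (((M i)%:R / N%:R) ^+ lattice_barycentric k i / (lattice_barycentric k i)`!%:R)
  = (N%:R ^+ n)^-1 * \prod_i ((M i)%:R ^+ lattice_barycentric k i / (lattice_barycentric k i)`!%:R) :> R.
  rewrite -[X in (_ ^+ X)^-1](sum_lattice_barycentric k) expr_sum -prodfV -big_split/=.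
  by apply: eq_bigr => i _; rewrite expr_div_n mulrA [X in X / _]mulrC.
set P := \prod_i _.
have P0 : 0 <= P by apply: prodr_ge0 => i _; rewrite divr_ge0// ltW.
have := exp_le_expR_ffact N0 nN; rewrite -bin_ffact natrM => h.
have Nn : 0 < N%:R ^+ n :> R by rewrite exprn_gt0.
rewrite -(ler_pM2r Nn).
set E := expR _ in h *.
have -> : E * n`!%:R * ((N%:R ^+ n)^-1 * P) * 'C(N, n)%:R * N%:R ^+ n =
  P * (E * ('C(N, n)%:R * n`!%:R)) by field; rewrite gt_eqF.
by rewrite ler_wpM2l.
Qed.

(** Minus the logarithm of the normal density at its mean: the determinant of
    n Sigma_p is the product of the d + 1 means l i divided by n. *)
Definition normal_log_const : R :=
  (d%:R * ln (2 * pi) + \sum_i ln (l i) - ln n%:R) / 2.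

(** A one-sided local limit theorem. Since the deviations add up to 0 and the
    means to n, the logarithmic terms of the Stirling bounds cancel, and the
    quadratic terms are absorbed by the Gaussian exponent on the left. *)
Lemma ln_hyper_weight_le (k : lattice_simplex d n) :
  0 < hyper_weight R M k ->
  ln (hyper_weight R M k) + normal_log_const + (\sum_i dev k i ^+ 2 / l i) / 2 <=
  4 * n%:R ^+ 2 / N%:R + (4 * n%:R)^-1 +
  \sum_i ((dev k i + 1) ^+ 3 / (6 * l i ^+ 2) - dev k i / (2 * l i)).
Proof.
move=> h0.
have f0 m : 0 < m`!%:R :> R by exact: factR_gt0.
have p0 i : 0 < (M i)%:R / N%:R :> R by rewrite divr_gt0 ?ltr0n.
have q0 i : 0 < ((M i)%:R / N%:R) ^+ lattice_barycentric k i / (lattice_barycentric k i)`!%:R :> R.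
  by rewrite divr_gt0// exprn_gt0.
have ln_prod (F : 'I_d.+1 -> R) : (forall i, 0 < F i) ->
    0 < \prod_i F i /\ ln (\prod_i F i) = \sum_i ln (F i).
  move=> F0; apply: (big_ind2 (fun a b => 0 < a /\ ln a = b)).
  - by rewrite ln1.
  - by move=> a b a' b' [a0 <-] [b0 <-]; rewrite mulr_gt0// lnM ?posrE.
  - by [].
have [P0 lnP] := ln_prod _ q0.
have := hyper_weight_le k.
have E0 : 0 < expR (4 * n%:R ^+ 2 / N%:R) * n`!%:R :> R.
  by apply: mulr_gt0; first exact: expR_gt0.
rewrite -ler_ln ?posrE//; last exact: mulr_gt0.
rewrite lnM ?posrE// lnM ?posrE ?expR_gt0// expRK lnP => h.
have {}h := le_trans h (lerD (lerD (lexx _) (ln_fact_le R n0)) (lexx _)).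
have ti i : ln (((M i)%:R / N%:R) ^+ lattice_barycentric k i / (lattice_barycentric k i)`!%:R) <=
  - (ln (2 * pi) / 2) - ln (l i) / 2 + l i - (lattice_barycentric k i)%:R * ln n%:R
  - dev k i ^+ 2 / l i / 2 + ((dev k i + 1) ^+ 3 / (6 * l i ^+ 2) - dev k i / (2 * l i)).
  rewrite ln_div ?posrE ?exprn_gt0// lnXn//.
  have -> : (M i)%:R / N%:R = l i / n%:R :> R.
    by rewrite /hyper_mean_at; field; rewrite !gt_eqF.
  have li := hyper_mean_at_gt0 i.
  rewrite ln_div ?posrE//.
  have := ln_fact_ge (lattice_barycentric k i) li.
  rewrite -[(ln _ - ln _) *+ _]mulr_natr.
  have -> : dev k i ^+ 2 / l i / 2 = dev k i ^+ 2 / (2 * l i) by field; rewrite gt_eqF.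
  move: (ln (lattice_barycentric k i)`!%:R) (ln (2 * pi)) (ln (l i)) (ln n%:R) => A B L Q.
  move: (dev k i ^+ 2 / (2 * l i)) ((dev k i + 1) ^+ 3 / (6 * l i ^+ 2)) (dev k i / (2 * l i)).
  move: ((lattice_barycentric k i)%:R : R) (l i) => x y a b c.
  nra.
have {}h := le_trans h (lerD (lexx _) (ler_sum _ (fun i _ => ti i))).
move: h; rewrite !big_split/= !sumrN sum_hyper_mean_at -!mulr_suml.
rewrite -natr_sum sum_lattice_barycentric sumr_const card_ord.
rewrite /normal_log_const -[_ *+ d.+1]mulr_natr -[d.+1%:R]natr1 => h.
move: (ln (2 * pi)) h => A h.
lra.
Qed.

Hypotheses (ltnN : (n < N)%N) (N2 : (2 < N)%N).

(** The expectation of ln_hyper_weight_le: the deviations average to 0 and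
    their cubes are controlled by hyper_central3. The constant B stands for what
    the average of the Gaussian exponent over a unit cube adds to its value at
    the centre. *)
Lemma hyper_relative_entropy_le (B : R) :
  \sum_(k : lattice_simplex d n) hyper_weight R M k *
    (ln (hyper_weight R M k) + normal_log_const
     + (\sum_i (dev k i) ^+ 2 / l i + B) / 2)
  <= 4 * n%:R ^+ 2 / N%:R + (4 * n%:R)^-1
     + \sum_i (4 * l i + 1) / (6 * l i ^+ 2) + B / 2.
Proof.
have nN' : (n <= N)%N by exact: ltnW.
pose K := 4 * n%:R ^+ 2 / N%:R + (4 * n%:R)^-1 + B / 2 : R.
have meanD i : \sum_(k : lattice_simplex d n) hyper_weight R M k * dev k i = 0.
  under eq_bigr do rewrite mulrBr.
  rewrite sumrB (hyper_mean R nN' N2) -mulr_suml hyper_sum1// mul1r subrr//.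
apply: (@le_trans _ _ (\sum_(k : lattice_simplex d n) hyper_weight R M k *
    (K + \sum_i ((dev k i + 1) ^+ 3 / (6 * l i ^+ 2) - dev k i / (2 * l i))))).
  apply: ler_sum => k _.
  have := hyper_weight_ge0 R M k; rewrite le_eqVlt => /orP[/eqP <-|h0].
    by rewrite !mul0r.
  rewrite ler_pM2l//; have := ln_hyper_weight_le h0; rewrite /K.
  lra.
under eq_bigr do rewrite mulrDr mulr_sumr.
rewrite big_split/= -mulr_suml hyper_sum1// mul1r exchange_big/=.
set S := \sum_(i < _) \sum_k _; set T := \sum_i _.
suff : S <= T by rewrite /K; move: S T (_ / N%:R) => S T a; lra.
rewrite {}/S {}/T; apply: ler_sum => i _.
have l0 := hyper_mean_at_gt0 i.
have -> : \sum_(k : lattice_simplex d n) hyper_weight R M k *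
      ((dev k i + 1) ^+ 3 / (6 * l i ^+ 2) - dev k i / (2 * l i)) =
    (\sum_(k : lattice_simplex d n) hyper_weight R M k * (dev k i + 1) ^+ 3)
      / (6 * l i ^+ 2) -
    (\sum_(k : lattice_simplex d n) hyper_weight R M k * dev k i) / (2 * l i).
  rewrite !mulr_suml -sumrB; apply: eq_bigr => k _.
  by rewrite mulrBr; congr (_ - _); exact: mulrA.
have l2 : 0 < 6 * l i ^+ 2 by apply: mulr_gt0 => //; exact: exprn_gt0.
rewrite meanD mul0r subr0 ler_pM2r ?invr_gt0//.
exact: hyper_central3.
Qed.

End log_bound.

(** * Iterated integrals over R^d *)

Section lebesgue_tuple_fubini.
Local Open Scope ereal_scope.
Context {R : realType}.
Local Notation RR := (measurableTypeR R).

Lemma ge0_integral_lebesgue_tupleS n (F : n.+1.-tuple RR -> \bar R) :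
  measurable_fun setT F -> (forall t, 0 <= F t) ->
  \int[lebesgue_tuple n.+1]_t F t =
  \int[@lebesgue_measure R]_x \int[lebesgue_tuple n]_t F (tuple_cons (x, t)).
Proof.
move=> mF F0.
transitivity (\int[pushforward (@lebesgue_measure R \x lebesgue_tuple n) (@tuple_cons R n)]_t F t).
  by [].
rewrite ge0_integral_pushforward//; last exact: measurable_tuple_cons.
rewrite preimage_setT fubini_tonelli1//; last by move=> t; exact: F0.
by apply: measurableT_comp => //; exact: measurable_tuple_cons.
Qed.

(** The cubes are centred at c, for the reason given at
    integral_cell_quadratic. *)
Definition cell d (c : 'I_d -> R) : set (d.-tuple RR) :=
  [set t | forall i, (c i - 2^-1 <= tnth t i < c i + 2^-1)%R].

Lemma measurable_cell d (c : 'I_d -> R) : measurable (cell c).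
Proof.
rewrite (_ : cell c = \bigcap_(i in setT) ((fun t : d.-tuple RR => tnth t i) @^-1` `[(c i - 2^-1)%R, (c i + 2^-1)%R[)).
  apply: fin_bigcap_measurable => [|i _]; first exact: finite_finset.
  by rewrite -[X in measurable X]setTI; apply: measurable_tnth => //; exact: measurable_itv.
apply/seteqP; split => t /=.
  by move=> h i _ /=; rewrite in_itv/=; exact: h.
by move=> h i; have := h i Logic.I; rewrite /= in_itv.
Qed.

Lemma cell_cons d (c : 'I_d.+1 -> R) x t :
  (tuple_cons (x, t) \in cell c) =
  (x \in `[(c ord0 - 2^-1)%R, (c ord0 + 2^-1)%R[%classic) && (t \in cell (c \o lift ord0)).
Proof.
apply/idP/andP; rewrite !inE/= in_itv/=.
  by move=> h; split; [have := h ord0; rewrite tnth0|move=> i /=; have := h (lift ord0 i); rewrite tnthS].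
move=> -[h0 h] i; case: (unliftP ord0 i) => [j ->|->]; last by rewrite tnth0.
by rewrite tnthS; exact: h.
Qed.

Lemma ge0_integral_cellS n (c : 'I_n.+1 -> R) (F : n.+1.-tuple RR -> \bar R) :
  measurable_fun setT F -> (forall t, 0 <= F t) ->
  \int[lebesgue_tuple n.+1]_(t in cell c) F t =
  \int[@lebesgue_measure R]_(x in `[(c ord0 - 2^-1)%R, (c ord0 + 2^-1)%R[)
     \int[lebesgue_tuple n]_(t in cell (c \o lift ord0)) F (tuple_cons (x, t)).
Proof.
move=> mF F0; rewrite integral_mkcond ge0_integral_lebesgue_tupleS; last 2 first.
- apply/(measurable_restrictT _ _).1 => //; first exact: measurable_cell.
  exact: measurable_funTS.
- by move=> t; rewrite patchE; case: ifP.
rewrite [RHS]integral_mkcond; apply: eq_integral => x _.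
rewrite [in RHS]patchE; case: ifPn => xI.
  rewrite [RHS]integral_mkcond; apply: eq_integral => t _.
  by rewrite !patchE cell_cons xI.
rewrite (eq_integral (cst 0)) ?integral0// => t _.
by rewrite patchE cell_cons (negbTE xI).
Qed.

End lebesgue_tuple_fubini.

Lemma integral_quadratic_itv (R : realType) (c al a b m s : R) :
  (\int[lebesgue_measure]_(x in `[(c - 2^-1)%R, (c + 2^-1)%R[)
     (al + a * (x - m) ^+ 2 + b * (s + x) ^+ 2)%:E =
  (al + a * ((c - m) ^+ 2 + 12^-1) + b * ((s + c) ^+ 2 + 12^-1))%:E)%E.
Proof.
pose f : R -> R := fun x => al + a * (x - m) ^+ 2 + b * (s + x) ^+ 2.
pose F : R -> R := fun x => al * x + a / 3 * (x - m) ^+ 3 + b / 3 * (s + x) ^+ 3.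
have dF (x : R) : is_derive x 1 F (f x).
  by rewrite /F /f; apply: is_derive_eq; rewrite /GRing.scale/=; field.
have cf : continuous f.
  move=> x; apply: differentiable_continuous; apply/derivable1_diffP.
  have : is_derive x 1 f (2 * a * (x - m) + 2 * b * (s + x)).
    by rewrite /f; apply: is_derive_eq; rewrite /GRing.scale/=; ring.
  by case.
rewrite integral_itv_bndo_bndc; last first.
  by apply: measurable_funTS; apply/measurable_EFinP; exact: continuous_measurable_fun.
have cc : c - 2^-1 < c + 2^-1 by lra.
rewrite (integral_FTC2 cc cf dF); congr EFin.
by rewrite /F; field.
Qed.

Lemma sqrt_expR_ln (R : realType) (y : R) : 0 < y -> Num.sqrt y = expR (ln y / 2).
Proof.
move=> y0; rewrite -[in LHS](lnK y0).
have -> : expR (ln y) = expR (ln y / 2) ^+ 2.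
  by rewrite -expRM_natl mulr_natl -[ _ *+ 2]mulr_natr divfK.
by rewrite sqrtr_sqr ger0_norm// expR_ge0.
Qed.

(** Completing the square: the product of the two Gaussian factors is a
    multiple of the normal density of variance a b / (a + b). *)
Lemma integral_gauss_pair (R : realType) (a b m s : R) : 0 < a -> 0 < b ->
  (\int[lebesgue_measure]_x
     (expR (- ((x - m) ^+ 2 / a + (s + (x - m)) ^+ 2 / b) / 2))%:E =
  (expR ((ln (2 * pi) + ln a + ln b - ln (a + b) - s ^+ 2 / (a + b)) / 2))%:E)%E.
Proof.
move=> a0 b0.
have ab0 : 0 < a + b by rewrite addr_gt0.
pose v := a * b / (a + b).
have v0 : 0 < v by rewrite divr_gt0// mulr_gt0.
pose sg := Num.sqrt v.
have sg2 : sg ^+ 2 = v by rewrite sqr_sqrtr// ltW.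
have sg0 : sg != 0 by rewrite gt_eqF// sqrtr_gt0.
pose mu := m - s * a / (a + b).
pose K := expR (- (s ^+ 2 / (a + b)) / 2) / normal_peak sg.
have p0 := normal_peak_gt0 sg0.
have fE x : expR (- ((x - m) ^+ 2 / a + (s + (x - m)) ^+ 2 / b) / 2) =
    K * normal_pdf mu sg x.
  rewrite normal_pdfE// /normal_fun sg2 /K mulrA divfK ?gt_eqF// -expRD; congr expR.
  by rewrite /mu /v -mulr_natr; field; rewrite !gt_eqF.
under eq_integral do rewrite fE EFinM.
rewrite ge0_integralZl_EFin//; last 3 first.
- by move=> x _; rewrite lee_fin normal_pdf_ge0.
- by apply/measurable_EFinP; exact: measurable_normal_pdf.
- by rewrite /K divr_ge0 ?expR_ge0// normal_peak_ge0.
rewrite integral_normal_pdf mule1; congr EFin.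
have -> : (ln (2 * pi) + ln a + ln b - ln (a + b) - s ^+ 2 / (a + b)) / 2 =
    - (s ^+ 2 / (a + b)) / 2 + (ln (2 * pi) + ln v) / 2.
  rewrite /v ln_div ?posrE ?mulr_gt0// [ln (a * b)]lnM ?posrE//.
  move: (ln (2 * pi)) => L; ring.
rewrite expRD /K; congr (_ * _).
rewrite /normal_peak invrK sg2.
have tp : 0 < 2 * pi :> R by rewrite pmulr_rgt0 ?pi_gt0.
rewrite (_ : v * pi *+ 2 = 2 * pi * v); last by ring.
have -> : ln (2 * pi) + ln v = ln (2 * pi * v) by rewrite [RHS]lnM ?posrE.
by rewrite sqrt_expR_ln// pmulr_rgt0.
Qed.

Section lebesgue_tuple_integrals.
Context {R : realType}.
Local Notation RR := (measurableTypeR R).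

Lemma tnth_tuple_cons0 n (x : RR) (t : n.-tuple RR) : tnth (tuple_cons (x, t)) ord0 = x.
Proof. by rewrite tnth0. Qed.

Lemma tnth_tuple_consS n (x : RR) (t : n.-tuple RR) i :
  tnth (tuple_cons (x, t)) (lift ord0 i) = tnth t i.
Proof. by rewrite tnthS. Qed.

Lemma integral_lebesgue_tuple0 (D : set (0.-tuple RR)) (f : 0.-tuple RR -> \bar R) :
  measurable D -> D [tuple] -> measurable_fun setT f ->
  (\int[@lebesgue_tuple R 0]_(t in D) f t = f [tuple])%E.
Proof.
move=> mD Dt mf; rewrite /= integral_dirac//; last exact: measurable_funTS.
by rewrite diracE mem_set// mul1e.
Qed.

Lemma measurable_cell_quadratic n (m a : 'I_n -> R) b s al :
  measurable_fun setT (fun t : n.-tuple RR =>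
    al + \sum_i a i * (tnth t i - m i) ^+ 2 + b * (s + \sum_i tnth t i) ^+ 2).
Proof.
apply: measurable_funD.
  apply: measurable_funD => //; apply: measurable_sum => i.
  apply: measurable_funM => //; apply: measurable_funX.
  by apply: measurable_funB => //; exact: measurable_tnth.
apply: measurable_funM => //; apply: measurable_funX; apply: measurable_funD => //.
by apply: measurable_sum => i; exact: measurable_tnth.
Qed.

(** In a centred unit cube the coordinates are independent with mean c i and
    variance 1 / 12, so that the square of their sum only grows by n / 12. An
    off-centre cube would shift the sum by a multiple of n, and its square by a
    multiple of n^2, too much for a bound of order d / sqrt n. *)
Lemma integral_cell_quadratic n (c m a : 'I_n -> R) b s al :
  0 <= al -> (forall i, 0 <= a i) -> 0 <= b ->
  (\int[lebesgue_tuple n]_(t in cell c)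
     (al + \sum_i a i * (tnth t i - m i) ^+ 2 + b * (s + \sum_i tnth t i) ^+ 2)%:E =
   (al + \sum_i a i * ((c i - m i) ^+ 2 + 12^-1)
       + b * ((s + \sum_i c i) ^+ 2 + n%:R / 12))%:E)%E.
Proof.
elim: n c m a s al => [|n IH] c m a s al al0 a0 b0.
  rewrite integral_lebesgue_tuple0; [|exact: measurable_cell|by case|]; last first.
    by apply/measurable_EFinP; exact: measurable_cell_quadratic.
  by rewrite !big_ord0 mul0r !addr0.
rewrite ge0_integral_cellS; last 2 first.
- by apply/measurable_EFinP; exact: measurable_cell_quadratic.
- move=> t; rewrite lee_fin; apply: addr_ge0; last by rewrite mulr_ge0// sqr_ge0.
  by apply: addr_ge0 => //; apply: sumr_ge0 => i _; rewrite mulr_ge0// sqr_ge0.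
pose a' i := a (lift ord0 i); pose m' i := m (lift ord0 i).
pose c' i := c (lift ord0 i).
transitivity (\int[lebesgue_measure]_(x in `[(c ord0 - 2^-1)%R, (c ord0 + 2^-1)%R[)
  (al + \sum_i a' i * ((c' i - m' i) ^+ 2 + 12^-1) + b * (n%:R / 12) + a ord0 * (x - m ord0) ^+ 2
     + b * (s + \sum_i c' i + x) ^+ 2)%:E)%E.
  apply: eq_integral => x _.
  have al'0 : 0 <= al + a ord0 * (x - m ord0) ^+ 2.
    by rewrite addr_ge0// mulr_ge0// sqr_ge0.
  transitivity (\int[lebesgue_tuple n]_(t in cell (c \o lift ord0))
     (al + a ord0 * (x - m ord0) ^+ 2 + \sum_i a' i * (tnth t i - m' i) ^+ 2
      + b * (s + x + \sum_i tnth t i) ^+ 2)%:E)%E.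
    apply: eq_integral => t _; rewrite !big_ord_recl tnth_tuple_cons0.
    under eq_bigr do rewrite tnth_tuple_consS.
    rewrite [X in s + (_ + X)](eq_bigr (tnth t)) => [|i _]; last by rewrite tnth_tuple_consS.
    by congr EFin; rewrite /a' /m'; ring.
  rewrite IH//; last by move=> i; exact: a0.
  by congr EFin; rewrite /c' /=; ring.
rewrite integral_quadratic_itv; congr EFin.
rewrite !big_ord_recl -[n.+1%:R]natr1 /a' /c' /m'; ring.
Qed.

Lemma measurable_gauss_simplex n (m a : 'I_n -> R) b s :
  measurable_fun setT (fun t : n.-tuple RR =>
     expR (- (\sum_i (tnth t i - m i) ^+ 2 / a i +
       (s + \sum_i (tnth t i - m i)) ^+ 2 / b) / 2)).
Proof.
apply: measurableT_comp => //; apply: measurable_funM => //.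
apply: measurableT_comp => //; apply: measurable_funD.
  apply: measurable_sum => i; apply: measurable_funM => //; apply: measurable_funX.
  by apply: measurable_funB => //; exact: measurable_tnth.
apply: measurable_funM => //; apply: measurable_funX; apply: measurable_funD => //.
apply: measurable_sum => i.
by apply: measurable_funB => //; exact: measurable_tnth.
Qed.

(** The coordinates are integrated out one at a time: by integral_gauss_pair,
    each of them merely adds its variance to b. *)
Lemma integral_gauss_simplex n (m a : 'I_n -> R) b s :
  (forall i, 0 < a i) -> 0 < b ->
  (\int[lebesgue_tuple n]_t
     (expR (- (\sum_i (tnth t i - m i) ^+ 2 / a i +
       (s + \sum_i (tnth t i - m i)) ^+ 2 / b) / 2))%:E =
   (expR ((n%:R * ln (2 * pi) + \sum_i ln (a i) + ln b - ln (b + \sum_i a i)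
      - s ^+ 2 / (b + \sum_i a i)) / 2))%:E)%E.
Proof.
elim: n m a s => [|n IH] m a s a0 b0.
  rewrite integral_lebesgue_tuple0//; last first.
    by apply/measurable_EFinP; exact: measurable_gauss_simplex.
  by rewrite !big_ord0 !addr0 mul0r !add0r subrr add0r.
rewrite ge0_integral_lebesgue_tupleS; last 2 first.
- by apply/measurable_EFinP; exact: measurable_gauss_simplex.
- by move=> t; rewrite lee_fin expR_ge0.
pose a' i := a (lift ord0 i); pose m' i := m (lift ord0 i).
pose b' := b + \sum_i a' i.
have b'0 : 0 < b' by rewrite ltr_pwDl// sumr_ge0// => i _; exact: ltW (a0 _).
pose K := expR ((n%:R * ln (2 * pi) + \sum_i ln (a' i) + ln b - ln b') / 2).
transitivity (\int[lebesgue_measure]_x (K%:E * (expR (- ((x - m ord0) ^+ 2 / a ord0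
   + (s + (x - m ord0)) ^+ 2 / b') / 2))%:E))%E.
  apply: eq_integral => x _.
  have := IH m' a' (s + (x - m ord0)) (fun i => a0 _) b0; rewrite -/b' => h.
  pose u := (x - m ord0) ^+ 2 / a ord0.
  transitivity ((expR (- u / 2))%:E * (\int[lebesgue_tuple n]_t
     (expR (- (\sum_i (tnth t i - m' i) ^+ 2 / a' i +
       (s + (x - m ord0) + \sum_i (tnth t i - m' i)) ^+ 2 / b) / 2))%:E))%E.
    rewrite -ge0_integralZl_EFin ?expR_ge0//; last first.
      by apply/measurable_EFinP; exact: measurable_gauss_simplex.
    apply: eq_integral => t _; rewrite !big_ord_recl tnth_tuple_cons0.
    under eq_bigr do rewrite tnth_tuple_consS.
    rewrite [X in s + (_ + X)](eq_bigr (fun i => tnth t i - m' i)) => [|i _]; last first.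
      by rewrite tnth_tuple_consS.
    rewrite -EFinM -expRD; congr EFin; congr expR.
    rewrite -/u /m' /a'; move: u (\sum_i _ / _) => u v.
    ring.
  rewrite h -!EFinM -!expRD; congr EFin; congr expR.
  rewrite -/u; move: (ln (2 * pi)) u => L u; ring.
rewrite ge0_integralZl_EFin ?expR_ge0//; last first.
  apply/measurable_EFinP; apply: measurableT_comp => //; apply: measurable_funM => //.
  apply: measurableT_comp => //; apply: measurable_funD; apply: measurable_funM => //;
  apply: measurable_funX.
  - by apply: measurable_funB.
  - by apply: measurable_funD => //; apply: measurable_funB.
rewrite integral_gauss_pair// -EFinM -expRD; congr EFin; congr expR.
rewrite !big_ord_recl -[n.+1%:R]natr1.
have -> : b + (a ord0 + \sum_i a (lift ord0 i)) = a ord0 + b' by rewrite /b' addrCA.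
rewrite /a'; move: (ln (2 * pi)) => L; ring.
Qed.

End lebesgue_tuple_integrals.

(** * The normal density *)

Section multinomial_cov.
Variables (R : realType) (d : nat) (a : 'rV[R]_d) (b : R).
Hypotheses (a0 : forall i, 0 < a 0 i) (b0 : 0 < b).
Let nu := b + \sum_i a 0 i.

Let nu0 : 0 < nu.
Proof. by rewrite /nu ltr_pwDl// sumr_ge0// => i _; exact: ltW. Qed.

Let one : 'rV[R]_d := const_mx 1.

(** The covariance of d independent variables of variances a i, given that
    their sum with one more independent variable, of variance b, is fixed. For
    a = n p and b = n p_(d+1) this is n Sigma_p. *)
Definition scaled_cov : 'M[R]_d := diag_mx a - nu^-1 *: (a^T *m a).
Definition scaled_cov_inv : 'M[R]_d :=
  diag_mx (\row_i (a 0 i)^-1) + b^-1 *: (one^T *m one).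

Let mul_a_one : a *m one^T = (\sum_i a 0 i)%:M.
Proof.
apply/matrixP => i j; rewrite !ord1 !mxE eqxx mulr1n.
by apply: eq_bigr => k _; rewrite !mxE mulr1.
Qed.

Let diag_one : diag_mx a *m one^T = a^T.
Proof.
by apply/matrixP => i j; rewrite mul_diag_mx !mxE ord1 mulr1.
Qed.

(** Two triangular factorizations of one bordered matrix: eliminating its last
    column gives the left-hand side times nu, eliminating its first block gives
    the product of the a i times b. *)
Lemma det_scaled_cov : \det scaled_cov = (\prod_i a 0 i) * b / nu.
Proof.
have e1 : block_mx (diag_mx a) a^T a nu%:M =
    block_mx 1%:M (nu^-1 *: a^T) 0 1%:M *m block_mx scaled_cov 0 a nu%:M.
  rewrite mulmx_block !mul1mx !mul0mx ?mulmx0 ?add0r /scaled_cov.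
  rewrite -scalemxAl subrK mul_mx_scalar scalerA divff ?gt_eqF// scale1r.
  by [].
have e2 : block_mx (diag_mx a) a^T a nu%:M =
    block_mx (diag_mx a) 0 a 1%:M *m block_mx 1%:M one^T 0 b%:M.
  rewrite mulmx_block !mulmx1 !mul1mx ?mulmx0 !mul0mx !addr0 diag_one mul_a_one.
  by rewrite -raddfD/= addrC.
have : \det (block_mx (diag_mx a) a^T a nu%:M) = \det scaled_cov * nu.
  by rewrite e1 det_mulmx det_ublock !det1 !mul1r det_lblock det_scalar1.
rewrite e2 det_mulmx det_lblock det_ublock !det1 det_diag det_scalar1 mul1r mulr1.
by move=> ->; rewrite mulfK// gt_eqF.
Qed.

(** This is the Sherman-Morrison formula. *)
Lemma mul_scaled_covV : scaled_cov *m scaled_cov_inv = 1%:M.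
Proof.
rewrite /scaled_cov /scaled_cov_inv mulmxBl !mulmxDr.
have -> : diag_mx a *m diag_mx (\row_i (a 0 i)^-1) = 1%:M.
  apply/matrixP => i j; rewrite mul_diag_mx !mxE.
  by case: eqP => [->|]; rewrite ?mulr1n ?mulr0n ?mulr0// divff// gt_eqF.
have -> : diag_mx a *m (b^-1 *: (one^T *m one)) = b^-1 *: (a^T *m one).
  by rewrite -scalemxAr mulmxA diag_one.
have aD : a *m diag_mx (\row_i (a 0 i)^-1) = one.
  by apply/matrixP => i j; rewrite mul_mx_diag !mxE ord1 divff// gt_eqF.
have -> : nu^-1 *: (a^T *m a) *m diag_mx (\row_i (a 0 i)^-1) = nu^-1 *: (a^T *m one).
  by rewrite -scalemxAl -mulmxA aD.
have -> : nu^-1 *: (a^T *m a) *m (b^-1 *: (one^T *m one)) =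
    (nu^-1 * b^-1 * (\sum_i a 0 i)) *: (a^T *m one).
  rewrite -scalemxAl -scalemxAr -mulmxA [a *m _]mulmxA mul_a_one mul_scalar_mx.
  by rewrite -scalemxAr !scalerA mulrA.
rewrite -scalerDl -addrA -scalerBl.
rewrite (_ : b^-1 - _ = 0) ?scale0r ?addr0//.
have -> : \sum_i a 0 i = nu - b by rewrite /nu addrC addKr.
by field; rewrite !gt_eqF.
Qed.

Lemma invmx_scaled_cov : invmx scaled_cov = scaled_cov_inv.
Proof.
have [u _] := mulmx1_unit mul_scaled_covV.
by rewrite -[RHS]mul1mx -(mulVmx u) -mulmxA mul_scaled_covV mulmx1.
Qed.

Lemma scaled_cov_quad (v : 'rV[R]_d) :
  (v *m invmx scaled_cov *m v^T) 0 0 =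
  \sum_i v 0 i ^+ 2 / a 0 i + (\sum_i v 0 i) ^+ 2 / b.
Proof.
rewrite invmx_scaled_cov /scaled_cov_inv mulmxDr mulmxDl mxE; congr (_ + _).
  rewrite !mxE; apply: eq_bigr => i _; rewrite mul_mx_diag !mxE expr2; ring.
have v1 : v *m one^T = (\sum_i v 0 i)%:M.
  apply/matrixP => i j; rewrite !ord1 !mxE eqxx mulr1n.
  by apply: eq_bigr => k _; rewrite !mxE mulr1.
have v2 : one *m v^T = (\sum_i v 0 i)%:M.
  by rewrite -[LHS]trmxK trmx_mul trmxK v1 tr_scalar_mx.
rewrite -scalemxAr mulmxA v1 mul_scalar_mx -!scalemxAl v2 !mxE eqxx mulr1n.
by rewrite expr2; ring.
Qed.

Lemma mvnormal_pdf_scaled_cov (t : d.-tuple (measurableTypeR R)) :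
  mvnormal_pdf a scaled_cov t =
  expR (- ((d%:R * ln (2 * pi) + \sum_i ln (a 0 i) + ln b - ln nu) / 2)) *
  expR (- (\sum_i (tnth t i - a 0 i) ^+ 2 / a 0 i +
    (0 + \sum_i (tnth t i - a 0 i)) ^+ 2 / b) / 2).
Proof.
rewrite /mvnormal_pdf scaled_cov_quad add0r; congr (_ * _); last first.
  have e i : (row_of_tuple t - a) 0 i = tnth t i - a 0 i by rewrite !mxE.
  have s1 : \sum_i (row_of_tuple t - a) 0 i = \sum_i (tnth t i - a 0 i).
    by apply: eq_bigr => i _; exact: e.
  have s2 : \sum_i (row_of_tuple t - a) 0 i ^+ 2 / a 0 i =
      \sum_i (tnth t i - a 0 i) ^+ 2 / a 0 i.
    by apply: eq_bigr => i _; rewrite e.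
  by rewrite s1 s2.
rewrite det_scaled_cov expRN; congr (_^-1).
have tp : 0 < 2 * pi :> R by rewrite pmulr_rgt0 ?pi_gt0.
move: (2 * pi) tp => P tp.
have Pa : 0 < \prod_i a 0 i by rewrite prodr_gt0.
have lnPa : ln (\prod_i a 0 i) = \sum_i ln (a 0 i).
  suff : 0 < \prod_i a 0 i /\ ln (\prod_i a 0 i) = \sum_i ln (a 0 i) by case.
  apply: (big_ind2 (fun x y => 0 < x /\ ln x = y)); rewrite ?ln1//.
  by move=> x x' y y' [x0 <-] [y0 <-]; rewrite mulr_gt0// lnM ?posrE.
rewrite sqrt_expR_ln; last by rewrite mulr_gt0 ?exprn_gt0// divr_gt0 ?mulr_gt0.
rewrite lnM ?posrE ?exprn_gt0 ?divr_gt0 ?mulr_gt0// lnXn//.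
rewrite ln_div ?posrE ?mulr_gt0// lnM ?posrE// lnPa -mulr_natl; congr expR.
by ring.
Qed.

End multinomial_cov.

(** * Total variation and Markov kernels *)

Section total_variation.
Local Open Scope ereal_scope.
Context {R : realType} d (T : measurableType d).

Definition finitely_additive (m : set T -> \bar R) :=
  forall n (P : {pred 'I_n}) (F : 'I_n -> set T),
    (forall i, measurable (F i)) -> trivIset setT F ->
    m (\big[setU/set0]_(i < n | P i) F i) = \sum_(i < n | P i) m (F i).

(** Since mu and nu have the same mass, the blocks of a partition where mu
    exceeds nu contribute as much to the sum as the other ones, and the former
    add up to the difference mu - nu of a single event. *)
Lemma tv_norm_le_one_sided (mu nu : set T -> \bar R) (e : R) :
  finitely_additive mu -> finitely_additive nu ->
  (forall A, 0 <= mu A) -> (forall A, 0 <= nu A) ->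
  mu setT = 1 -> nu setT = 1 ->
  (forall A, measurable A -> mu A <= nu A + e%:E) ->
  tv_norm (fun A => mu A - nu A) <= (2 * e)%:E /\
  tv_norm (fun A => nu A - mu A) <= (2 * e)%:E.
Proof.
move=> amu anu mu0 nu0 mu1 nu1 le.
suff H n (A : 'I_n -> set T) : (forall i, measurable (A i)) -> trivIset setT A ->
    \bigcup_i A i = setT ->
    \sum_(i < n) `|mu (A i) - nu (A i)| <= (2 * e)%:E /\
    \sum_(i < n) `|nu (A i) - mu (A i)| <= (2 * e)%:E.
  by split; apply: ge_ereal_sup => _ [n [A [mA tA cA ->]]]; have [] := H n A mA tA cA.
move=> mA tA cA.
have bigA : \big[setU/set0]_(i < n) A i = setT.
  rewrite -cA -bigcup_seq; congr bigcup.
  by apply/seteqP; split => i // _; rewrite /= mem_index_enum.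
have fin (m : set T -> \bar R) : finitely_additive m -> (forall A, 0 <= m A) ->
    m setT = 1 -> forall i, m (A i) = (fine (m (A i)))%:E.
  move=> am m0 m1 i; rewrite fineK// ge0_fin_numE//.
  apply: (@le_lt_trans _ _ 1); last exact: ltry.
  rewrite -m1 -bigA (am _ predT)//= (bigD1 i)//=.
  by rewrite leeDl// sume_ge0.
pose x i := fine (mu (A i)); pose y i := fine (nu (A i)).
have xE i : mu (A i) = (x i)%:E by exact: fin.
have yE i : nu (A i) = (y i)%:E by exact: fin.
have x1 : (\sum_i x i = 1)%R.
  apply: EFin_inj; rewrite -sumEFin -mu1 -bigA (amu _ predT)//=.
  by apply: eq_bigr => i _; rewrite xE.
have y1 : (\sum_i y i = 1)%R.
  apply: EFin_inj; rewrite -sumEFin -nu1 -bigA (anu _ predT)//=.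
  by apply: eq_bigr => i _; rewrite yE.
pose P : {pred 'I_n} := fun i => (y i <= x i)%R.
have xyP : (\sum_(i | P i) x i <= \sum_(i | P i) y i + e)%R.
  rewrite -lee_fin EFinD -!sumEFin.
  have mU : measurable (\big[setU/set0]_(i < n | P i) A i).
    by apply: bigsetU_measurable.
  have := le _ mU; rewrite amu// anu//.
  under eq_bigr do rewrite xE.
  by under [X in _ <= X + _ -> _]eq_bigr do rewrite yE.
have key : (\sum_i `|x i - y i| <= 2 * e)%R.
  have -> : (\sum_i `|x i - y i| = \sum_(i | P i) (x i - y i) - \sum_(i | ~~ P i) (x i - y i))%R.
    rewrite (bigID P)/= -sumrN; congr (_ + _)%R; apply: eq_bigr => i.
      by rewrite /P => ?; rewrite ger0_norm// subr_ge0.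
    by rewrite /P -ltNge => ?; rewrite ltr0_norm// subr_lt0.
  have : (\sum_i (x i - y i) = 0)%R by rewrite sumrB x1 y1 subrr.
  rewrite (bigID P)/=; move: xyP; rewrite -lerBlDl -sumrB.
  move: (\sum_(i | P i) _)%R (\sum_(i | ~~ P i) _)%R => a b; lra.
split.
  under eq_bigr do rewrite xE yE -EFinB abse_EFin.
  by rewrite sumEFin lee_fin.
under eq_bigr do rewrite xE yE -EFinB abse_EFin distrC.
by rewrite sumEFin lee_fin.
Qed.

End total_variation.

Section kernel_mix_lemmas.
Local Open Scope ereal_scope.
Context {R : realType} d1 d2 (X : measurableType d1) (Y : measurableType d2).
Variables (K : R.-pker X ~> Y) (P : {measure set X -> \bar R}).

Lemma kernel_mix_additive : finitely_additive (kernel_mix K P).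
Proof.
move=> n S F mF tF; rewrite /kernel_mix.
under eq_integral do rewrite measure_bigsetU_ord// -big_filter.
rewrite ge0_integral_sum//; first by rewrite big_filter.
by move=> i; exact: measurable_kernel.
Qed.

Lemma kernel_mix_ge0 A : 0 <= kernel_mix K P A.
Proof. by apply: integral_ge0. Qed.

Lemma kernel_mixT : kernel_mix K P setT = P setT.
Proof.
rewrite /kernel_mix; under eq_integral do rewrite prob_kernel.
by rewrite integral_cst// mul1e.
Qed.

End kernel_mix_lemmas.

(** * Smoothing and rounding *)

Section hypergeometric_integral.
Local Open Scope ereal_scope.
Context {R : realType}.
Variables (d N n : nat) (p : 'rV[R]_d).

Lemma integral_hypergeometric (g : lattice_simplex d n -> \bar R) :
  (forall k, 0 <= g k) ->
  \int[hypergeometric N n p]_k g k =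
  \sum_(k : lattice_simplex d n) (hypergeometric_pmf N n p k)%:E * g k.
Proof.
move=> g0.
have -> : [set: lattice_simplex d n] =
    \big[setU/set0]_(k <- index_enum (lattice_simplex d n)) [set k].
  rewrite -bigcup_seq; apply/seteqP; split => k // _.
  by exists k => //=; rewrite mem_index_enum.
rewrite ge0_integral_bigsetU//; last 2 first.
- exact: index_enum_uniq.
- apply/trivIsetP => i j _ _ ij; rewrite set1I; case: ifPn => // /set_mem /= ij'.
  by rewrite ij' eqxx in ij.
apply: eq_bigr => k _.
rewrite (eq_integral (cst (g k))); last by move=> x; rewrite inE => ->.
rewrite integral_cst// muleC; congr (_ * _).
by rewrite /= /hypergeometric esum_set1// lee_fin hypergeometric_pmf_ge0.
Qed.

Lemma hypergeometricE (U : set (lattice_simplex d n)) :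
  hypergeometric N n p U =
  \sum_(k : lattice_simplex d n) (hypergeometric_pmf N n p k)%:E * \d_k U.
Proof.
rewrite -integral_hypergeometric//.
rewrite (eq_integral (fun k => (\1_U k)%:E)) => [|k _]; last by rewrite diracE indicE.
by rewrite integral_indic// setIT.
Qed.

End hypergeometric_integral.

Section rounding.
Local Open Scope ereal_scope.
Context {R : realType}.
Variables (d n : nat).
Local Notation RR := (measurableTypeR R).

Definition lattice_point (k : lattice_simplex d n) (i : 'I_d) : R := (val k i)%:R.

Definition lattice_cell (k : lattice_simplex d n) : set (d.-tuple RR) :=
  cell (lattice_point k).

Lemma measurable_lattice_cell k : measurable (lattice_cell k).
Proof. exact: measurable_cell. Qed.

Lemma lattice_cell_inj k k' t : lattice_cell k t -> lattice_cell k' t -> k = k'.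
Proof.
move=> h h'; apply/val_inj/ffunP => i; apply/val_inj/eqP => /=.
have := h i; have := h' i; rewrite /lattice_point => /andP[a b] /andP[a' b'].
have le_of (x y : nat) : (x%:R < y%:R + 1 :> R)%R -> (x <= y)%N.
  by rewrite natr1 ltr_nat ltnS.
by rewrite eqn_leq; apply/andP; split; apply: le_of; lra.
Qed.

(** The smoothed law is carried by the cells, so that any value will do
    outside of them. *)
Definition round_lattice (t : d.-tuple RR) : lattice_simplex d n :=
  odflt point [pick k | `[< lattice_cell k t >]].

Lemma round_lattice_cell k t : lattice_cell k t -> round_lattice t = k.
Proof.
move=> kt; rewrite /round_lattice; case: pickP => [k' /asboolP k't|/(_ k)/asboolP//].
exact: lattice_cell_inj k't kt.
Qed.

Lemma measurable_round_lattice : measurable_fun setT round_lattice.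
Proof.
move=> _ B _; rewrite setTI.
pose V := \bigcup_(k in [set: lattice_simplex d n]) lattice_cell k.
have mV : measurable V.
  by apply: fin_bigcup_measurable => [|k _]; [exact: finite_finset|exact: measurable_lattice_cell].
have mVB : measurable (\bigcup_(k in B) lattice_cell k).
  by apply: fin_bigcup_measurable => [|k _]; [exact: finite_finset|exact: measurable_lattice_cell].
have -> : round_lattice @^-1` B = \bigcup_(k in B) lattice_cell k `|`
    (if point \in B then ~` V else set0).
  apply/seteqP; split => t /=.
    move=> Bt; have [[k _ kt]|nV] := pselect (V t).
      by left; exists k => //; rewrite -(round_lattice_cell kt).
    right; have rp : round_lattice t = point.
      rewrite /round_lattice; case: pickP => // k /asboolP kt.
      by exfalso; apply: nV; exists k.
    by move: Bt; rewrite rp => /mem_set ->.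
  case => [[k Bk kt]|]; first by rewrite (round_lattice_cell kt).
  case: ifPn => // /set_mem Bp nV.
  rewrite /round_lattice; case: pickP => // k /asboolP kt.
  by exfalso; apply: nV; exists k.
apply: measurableU => //; case: ifP => // _; exact: measurableC.
Qed.

Lemma lattice_cell_measure k : lebesgue_tuple d (lattice_cell k) = 1.
Proof.
have := @integral_cell_quadratic R d (lattice_point k) (fun=> 0%R) (fun=> 0%R) 0%R 0%R 1%R
  ler01 (fun=> lexx _) (lexx _).
rewrite (eq_integral (cst 1)) => [|t _]; last first.
  by rewrite big1 => [|i _]; rewrite mul0r ?addr0.
rewrite integral_cst ?mul1e; last exact: measurable_lattice_cell.
move=> ->; rewrite mul0r big1 => [|i _]; last by rewrite mul0r.
by rewrite !addr0.
Qed.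

Definition cell_kernel (k : lattice_simplex d n) : {measure set (d.-tuple RR) -> \bar R} :=
  mrestr (lebesgue_tuple d) (measurable_lattice_cell k).

Let measurable_cell_kernel (U : set (d.-tuple RR)) : measurable U ->
  measurable_fun [set: lattice_simplex d n] (cell_kernel ^~ U).
Proof. by []. Qed.

HB.instance Definition _ := isKernel.Build _ _ _ _ _ cell_kernel measurable_cell_kernel.

Let cell_kernel_prob k : cell_kernel k [set: _] = 1.
Proof. by rewrite /cell_kernel/= /mrestr setTI lattice_cell_measure. Qed.

HB.instance Definition _ := Kernel_isProbability.Build _ _ _ _ _
  cell_kernel cell_kernel_prob.

End rounding.

(** * From relative entropy to a comparison of measures *)

(** A pointwise form of Pinsker's inequality, with f and q = expR L as
    densities. Put s = sqrt f and r = sqrt q. The entropy integrand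
    f ln (f / q) - f + q is at least (s - r)^2, while
    f - q = (s - r) (s + r) is at most (s - r)^2 / (2e) + e (s + r)^2 / 2.
    Being pointwise, the bound can be integrated cell by cell and only over the
    event at hand. *)
Lemma le_add_relative_entropy (R : realType) (e f L : R) : 0 < e -> 0 <= f ->
  let psi := (f * ln f - f * L - f + expR L) / (2 * e) + e * (f + expR L) in
  0 <= psi /\ f <= expR L + psi.
Proof.
move=> e0 f0 /=; have q0 := expR_gt0 L.
have e20 : 0 < 2 * e by rewrite mulr_gt0.
move: f0; rewrite le_eqVlt => /orP[/eqP <-|f0].
  rewrite !mul0r subr0 subrr !add0r.
  have ? : 0 <= expR L / (2 * e) by rewrite divr_ge0 ?ltW.
  have ? : 0 <= e * expR L by rewrite mulr_ge0 ?ltW.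
  by split; lra.
pose s := expR (ln f / 2); pose r := expR (L / 2).
have s0 : 0 < s := expR_gt0 _.
have r0 : 0 < r := expR_gt0 _.
have sE : f = s ^+ 2 by rewrite /s -expRM_natl mulrC divfK// lnK ?posrE.
have rE : expR L = r ^+ 2 by rewrite /r -expRM_natl mulrC divfK.
have h : 1 + (L / 2 - ln f / 2) <= r / s.
  by apply: le_trans (expR_ge1Dx _) _; rewrite expRB.
have key : (s - r) ^+ 2 <= f * ln f - f * L - f + expR L.
  have : f * (1 + (L / 2 - ln f / 2)) <= s * r.
    apply: (@le_trans _ _ (f * (r / s))); first by rewrite ler_wpM2l// ltW.
    by rewrite sE le_eqVlt; apply/orP; left; apply/eqP; field; rewrite gt_eqF.
  rewrite rE sqrrB -sE; move: (s * r) (ln f) => sr lf H; rewrite mulr2n; nra.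
have amgm : s ^+ 2 - r ^+ 2 <= (s - r) ^+ 2 / (2 * e) + e * (s ^+ 2 + r ^+ 2).
  have -> : (s - r) ^+ 2 / (2 * e) + e * (s ^+ 2 + r ^+ 2) =
      s ^+ 2 - r ^+ 2 + ((s - r) - e * (s + r)) ^+ 2 / (2 * e) + e * (s - r) ^+ 2 / 2.
    by field; rewrite gt_eqF.
  rewrite -addrA lerDl; apply: addr_ge0.
    by apply: divr_ge0; [exact: sqr_ge0|exact: ltW].
  by apply: divr_ge0 => //; apply: mulr_ge0; [exact: ltW|exact: sqr_ge0].
have k2 : (s - r) ^+ 2 / (2 * e) <= (f * ln f - f * L - f + expR L) / (2 * e).
  by rewrite ler_pM2r// invr_gt0.
split.
  apply: addr_ge0; last by apply: mulr_ge0; [exact: ltW|apply: addr_ge0; exact: ltW].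
  by apply: le_trans k2; apply: divr_ge0; [exact: sqr_ge0|exact: ltW].
move: k2 amgm; rewrite -sE -rE; lra.
Qed.

Section smoothing.
Context {R : realType}.
Local Notation RR := (measurableTypeR R).
Variables (d n : nat) (a : 'rV[R]_d) (b : R).
Hypotheses (a0 : forall i, 0 < a 0 i) (b0 : 0 < b).

Definition gauss_quad (t : d.-tuple RR) : R :=
  \sum_i (tnth t i - a 0 i) ^+ 2 / a 0 i + (0 + \sum_i (tnth t i - a 0 i)) ^+ 2 / b.

Definition gauss_log_const : R :=
  (d%:R * ln (2 * pi) + \sum_i ln (a 0 i) + ln b - ln (b + \sum_i a 0 i)) / 2.

Definition gauss_quad_cell_mean (k : lattice_simplex d n) : R :=
  \sum_i ((lattice_point k i - a 0 i) ^+ 2 + 12^-1) / a 0 i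
  + ((\sum_i (lattice_point k i - a 0 i)) ^+ 2 + d%:R / 12) / b.

Local Notation Q := (mvnormal a (scaled_cov a b)).
Local Notation c := gauss_log_const.

Lemma mvnormal_pdf_expR t :
  mvnormal_pdf a (scaled_cov a b) t = expR (- c - gauss_quad t / 2).
Proof. by rewrite mvnormal_pdf_scaled_cov// expRD mulNr. Qed.

Lemma mvnormal_setT : Q setT = 1%E.
Proof.
rewrite /mvnormal.
under eq_integral do rewrite mvnormal_pdf_scaled_cov// EFinM.
rewrite ge0_integralZl_EFin ?expR_ge0//; last first.
  by apply/measurable_EFinP; exact: measurable_gauss_simplex.
rewrite integral_gauss_simplex// -EFinM -expRD.
by rewrite expr0n/= mul0r subr0 addNr expR0.
Qed.

Lemma gauss_quadE g (t : d.-tuple RR) : g * gauss_quad t =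
  0 + \sum_i g / a 0 i * (tnth t i - a 0 i) ^+ 2
    + g / b * (- (\sum_i a 0 i) + \sum_i tnth t i) ^+ 2.
Proof.
rewrite /gauss_quad mulrDr !add0r mulr_sumr; congr (_ + _).
  by apply: eq_bigr => i _; rewrite mulrCA mulrC.
by rewrite sumrB [- _ + _]addrC; ring.
Qed.

Lemma integral_cell_gauss_quad al g (k : lattice_simplex d n) : 0 <= al -> 0 <= g ->
  (\int[lebesgue_tuple d]_(t in lattice_cell k) (al + g * gauss_quad t)%:E =
   (al + g * gauss_quad_cell_mean k)%:E)%E.
Proof.
move=> al0 g0.
under eq_integral do rewrite gauss_quadE add0r addrA.
rewrite integral_cell_quadratic//; last 2 first.
- by move=> i; rewrite divr_ge0// ltW.
- by rewrite divr_ge0// ltW.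
congr EFin; rewrite /gauss_quad_cell_mean [g * (_ + _)]mulrDr mulr_sumr -addrA; congr (_ + (_ + _)).
  by apply: eq_bigr => i _; rewrite mulrCA mulrC.
by rewrite sumrB [- _ + _]addrC; ring.
Qed.

Lemma measurable_gauss_quad : measurable_fun setT gauss_quad.
Proof.
rewrite (_ : gauss_quad = fun t =>  0 + \sum_i 1 / a 0 i * (tnth t i - a 0 i) ^+ 2
    + 1 / b * (- (\sum_i a 0 i) + \sum_i tnth t i) ^+ 2).
  exact: measurable_cell_quadratic.
by apply/funext => t; rewrite -gauss_quadE mul1r.
Qed.

Lemma gauss_quad_ge0 t : 0 <= gauss_quad t.
Proof.
apply: addr_ge0; last by rewrite divr_ge0 ?sqr_ge0// ltW.
by apply: sumr_ge0 => i _; rewrite divr_ge0 ?sqr_ge0// ltW.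
Qed.

Lemma mvnormal_fin (A : set (d.-tuple RR)) : measurable A -> Q A \is a fin_num.
Proof.
move=> mA; rewrite ge0_fin_numE//; apply: (@le_lt_trans _ _ 1%E); last exact: ltry.
by rewrite -mvnormal_setT; apply: le_measure; rewrite ?inE.
Qed.

Lemma sum_mvnormal_cell_le (A : set (d.-tuple RR)) : measurable A ->
  (\sum_(k : lattice_simplex d n) Q (A `&` lattice_cell k) <= Q A)%E.
Proof.
move=> mA.
have mAc (k : lattice_simplex d n) : measurable (A `&` lattice_cell k : set (d.-tuple RR)).
  by apply: measurableI => //; exact: measurable_lattice_cell.
have mq : measurable_fun setT (fun t : d.-tuple RR => (mvnormal_pdf a (scaled_cov a b) t)%:E).
  by apply/measurable_EFinP; exact: measurable_mvnormal_pdf.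
have mU : measurable (\big[setU/set0]_(k <- index_enum (lattice_simplex d n))
    (A `&` lattice_cell k) : set (d.-tuple RR)).
  exact: bigsetU_measurable.
rewrite /mvnormal -ge0_integral_bigsetU//.
- apply: ge0_subset_integral => //.
  + exact: measurable_funTS.
  + by move=> t _; rewrite lee_fin mvnormal_pdf_ge0.
  + by rewrite -bigcup_seq => t [k _ []].
- exact: index_enum_uniq.
- apply/trivIsetP => i j _ _ ij; apply/seteqP; split => // t [[_ ti] [_ tj]].
  by move: ij; rewrite (lattice_cell_inj ti tj) eqxx.
- exact: measurable_funTS.
- by move=> t _; rewrite lee_fin mvnormal_pdf_ge0.
Qed.

Variable h : lattice_simplex d n -> R.
Hypotheses (h0 : forall k, 0 <= h k) (h1 : \sum_k h k = 1).

(** On the cell of k the smoothed law has the constant density h k, to which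
    le_add_relative_entropy is applied; the nonnegative correction is then
    integrated over the whole cell. *)
Lemma smoothed_cell_le (A : set (d.-tuple RR)) (k : lattice_simplex d n) e :
  measurable A -> 0 < e ->
  ((h k)%:E * lebesgue_tuple d (A `&` lattice_cell k) <=
   Q (A `&` lattice_cell k) +
   (((h k * (ln (h k) + c + gauss_quad_cell_mean k / 2) - h k) / (2 * e) + e * h k) %:E
    + ((2 * e)^-1 + e)%:E * Q (lattice_cell k)))%E.
Proof.
move=> mA e0.
have e20 : 0 < 2 * e by rewrite mulr_gt0.
have mC := measurable_lattice_cell k (R := R).
have mAc : measurable (A `&` lattice_cell k : set (d.-tuple RR)) by exact: measurableI.
pose q := mvnormal_pdf a (scaled_cov a b).
have mq : measurable_fun setT (fun t : d.-tuple RR => (q t)%:E).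
  by apply/measurable_EFinP; exact: measurable_mvnormal_pdf.
have q0 t : 0 <= q t by exact: mvnormal_pdf_ge0.
pose be := (h k * (ln (h k) + c) - h k) / (2 * e) + e * h k.
pose g := h k / (4 * e).
have g0 : 0 <= g by rewrite divr_ge0// mulr_ge0// ltW.
pose D := (2 * e)^-1 + e.
have D0 : 0 <= D by rewrite addr_ge0 ?invr_ge0 ?ltW.
pose psi (t : d.-tuple RR) := be + g * gauss_quad t + D * q t.
have psiE t : psi t = (h k * ln (h k) - h k * (- c - gauss_quad t / 2) - h k
     + expR (- c - gauss_quad t / 2)) / (2 * e)
     + e * (h k + expR (- c - gauss_quad t / 2)).
  rewrite /psi /q mvnormal_pdf_expR /be /g /D.
  move: (expR (- c - gauss_quad t / 2)) (gauss_quad t) c (ln (h k)) => x y z w.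
  by field; rewrite gt_eqF.
have psi0 t : 0 <= psi t by rewrite psiE; have [] := le_add_relative_entropy (- c - gauss_quad t / 2) e0 (h0 k).
have hpsi t : h k <= q t + psi t.
  rewrite psiE /q mvnormal_pdf_expR.
  by have [] := le_add_relative_entropy (- c - gauss_quad t / 2) e0 (h0 k).
have mpsi : measurable_fun setT (fun t => (psi t)%:E).
  apply/measurable_EFinP; apply: measurable_funD.
    apply: measurable_funD => //; apply: measurable_funM => //.
    exact: measurable_gauss_quad.
  by apply: measurable_funM => //; exact: measurable_mvnormal_pdf.
(* The constant term be of psi may be negative: its negative part bm is moved
   to the other side, where both integrands are nonnegative. *)
have intpsi : (\int[lebesgue_tuple d]_(t in lattice_cell k) (psi t)%:E =
    (be + g * gauss_quad_cell_mean k)%:E + D%:E * Q (lattice_cell k))%E.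
  pose bp := Num.max be 0; pose bm := Num.max (- be) 0.
  have bp0 : 0 <= bp by rewrite /bp le_max lexx orbT.
  have bm0 : 0 <= bm by rewrite /bm le_max lexx orbT.
  have bE : be = bp - bm.
    rewrite /bp /bm; case: (leP be 0) => be0; case: (leP (- be) 0) => be1; lra.
  have : (\int[lebesgue_tuple d]_(t in lattice_cell k) ((psi t)%:E + bm%:E) =
      \int[lebesgue_tuple d]_(t in lattice_cell k)
        ((bp + g * gauss_quad t)%:E + (D%:E * (q t)%:E)))%E.
    apply: eq_integral => t _; rewrite -EFinM -!EFinD; congr EFin.
    by rewrite /psi bE; ring.
  rewrite ge0_integralD//; last 2 first.
  - by move=> t _; rewrite lee_fin.
  - exact: measurable_funTS.
  rewrite ge0_integralD//; last 4 first.
  - by move=> t _; rewrite lee_fin addr_ge0// mulr_ge0// gauss_quad_ge0.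
  - apply/measurable_EFinP; apply: measurable_funTS; apply: measurable_funD => //.
    by apply: measurable_funM => //; exact: measurable_gauss_quad.
  - by move=> t _; rewrite -EFinM lee_fin mulr_ge0.
  - by apply: measurable_funTS; apply: emeasurable_funM.
  rewrite integral_cell_gauss_quad// ge0_integralZl_EFin//; last 2 first.
  - by move=> t _; rewrite lee_fin.
  - exact: measurable_funTS.
  have -> : (\int[lebesgue_tuple d]_(t in lattice_cell k) bm%:E = bm%:E)%E.
    rewrite (eq_integral (cst bm%:E))// integral_cst//.
    by rewrite [X in (_ * X)%E]lattice_cell_measure mule1.
  rewrite -/(mvnormal a (scaled_cov a b) (lattice_cell k)).
  have Qfin := mvnormal_fin mC.
  rewrite -(fineK Qfin) -EFinM -!EFinD.
  move=> /(congr1 (fun z => z - bm%:E)%E); rewrite addeK// => ->.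
  by rewrite -EFinB bE; congr EFin; ring.
have -> : (h k * (ln (h k) + c + gauss_quad_cell_mean k / 2) - h k) / (2 * e) + e * h k =
    be + g * gauss_quad_cell_mean k.
  rewrite /be /g; move: c (ln (h k)) (gauss_quad_cell_mean k) => x y z.
  by field; rewrite gt_eqF.
rewrite -/D -intpsi.
rewrite -(integral_cst (lebesgue_tuple d) mAc (h k)%:E).
apply: (@le_trans _ _ (\int[lebesgue_tuple d]_(t in A `&` lattice_cell k) ((q t)%:E + (psi t)%:E))%E).
  apply: ge0_le_integral => //.
  - by move=> t _; rewrite lee_fin.
  - by apply: measurable_funTS; apply: emeasurable_funD.
  - by move=> t _; rewrite -EFinD lee_fin.
rewrite ge0_integralD//; last 4 first.
- by move=> t _; rewrite lee_fin.
- exact: measurable_funTS.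
- by move=> t _; rewrite lee_fin.
- exact: measurable_funTS.
apply: leeD => //; apply: ge0_subset_integral => //.
- exact: measurable_funTS.
- by move=> t _; rewrite lee_fin.
Qed.

(** In the sum of smoothed_cell_le over the cells, the terms - f + q of the
    entropy integrand contribute at most - 1 + 1 = 0, and e (f + q) at most
    2 e. *)
Lemma smoothed_le (A : set (d.-tuple RR)) e : measurable A -> 0 < e ->
  (\sum_(k : lattice_simplex d n) (h k)%:E * lebesgue_tuple d (A `&` lattice_cell k) <=
   Q A + ((\sum_(k : lattice_simplex d n) h k * (ln (h k) + c + gauss_quad_cell_mean k / 2)) / (2 * e)
          + 2 * e)%:E)%E.
Proof.
move=> mA e0.
have e20 : 0 < 2 * e by rewrite mulr_gt0.
have D0 : 0 <= (2 * e)^-1 + e by rewrite addr_ge0 ?invr_ge0 ?ltW.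
apply: le_trans (lee_sum _ (fun k _ => smoothed_cell_le k mA e0)) _.
rewrite big_split/=; apply: leeD; first exact: sum_mvnormal_cell_le.
rewrite big_split/= sumEFin -ge0_sume_distrr//.
apply: (@le_trans _ _ ((\sum_(k : lattice_simplex d n) ((h k * (ln (h k) + c + gauss_quad_cell_mean k / 2) - h k) / (2 * e) + e * h k))%:E + ((2 * e)^-1 + e)%:E * 1)%E).
  apply: leeD => //; apply: lee_wpmul2l; first by rewrite lee_fin.
  rewrite -mvnormal_setT; apply: le_trans (sum_mvnormal_cell_le measurableT).
  by rewrite le_eqVlt; apply/orP; left; apply/eqP; apply: eq_bigr => k _; rewrite setTI.
rewrite mule1 -EFinD lee_fin big_split/= -mulr_suml sumrB -mulr_sumr h1.
move: (\sum_k _) => S; rewrite le_eqVlt; apply/orP; left; apply/eqP.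
by field; rewrite gt_eqF.
Qed.

End smoothing.

(** * The parameter set *)

Section theta.
Context {R : realType}.
Variables (d n N : nat) (r : R) (p : 'rV[R]_d).
Hypotheses (d0 : (0 < d)%N) (n0 : (0 < n)%N) (N0 : (0 < N)%N) (pT : Theta d N r p).

Let NR : 0 < N%:R :> R. Proof. by rewrite ltr0n. Qed.
Let nR : 0 < n%:R :> R. Proof. by rewrite ltr0n. Qed.
Let dR : 1 <= d%:R :> R. Proof. by rewrite ler1n. Qed.

Let p01 i : 0 < p 0 i < 1.
Proof. by case: pT => _ [+ _] _; apply. Qed.

Lemma norm1_theta : norm1 p = \sum_i p 0 i.
Proof. by apply: eq_bigr => i _; rewrite gtr0_norm//; have /andP[] := p01 i. Qed.

Lemma barycentric_lift i : barycentric p (lift ord_max i) = p 0 i.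
Proof. by rewrite /barycentric liftK. Qed.

Lemma barycentric_max : barycentric p ord_max = 1 - norm1 p.
Proof. by rewrite /barycentric unlift_none. Qed.

Lemma widen_lift_max (i : 'I_d) : widen_ord (leqnSn d) i = lift ord_max i.
Proof. by apply/val_inj; rewrite /= /bump leqNgt ltn_ord. Qed.

Lemma barycentric_gt0 i : 0 < barycentric p i.
Proof.
case: (unliftP ord_max i) => [j ->|->].
  by rewrite barycentric_lift; have /andP[] := p01 j.
by rewrite barycentric_max subr_gt0; case: pT => _ [_ +] _.
Qed.

Lemma sum_barycentric : \sum_i barycentric p i = 1.
Proof.
rewrite big_ord_recr/= barycentric_max norm1_theta.
under eq_bigr do rewrite widen_lift_max barycentric_lift.
by rewrite addrC subrK.
Qed.

Definition theta_count (i : 'I_d.+1) : nat := Num.truncn (N%:R * barycentric p i).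
Local Notation M := theta_count.

Lemma theta_countE i : (M i)%:R = N%:R * barycentric p i.
Proof.
case: pT => -[m pm] _ _.
have Np j : N%:R * p 0 j = (m j)%:R by rewrite pm mulrC divfK// gt_eqF.
rewrite /M; case: (unliftP ord_max i) => [j ->|->].
  by rewrite barycentric_lift Np natrK.
rewrite barycentric_max mulrBr mulr1 norm1_theta mulr_sumr.
under eq_bigr do rewrite Np.
rewrite -natr_sum -natrB ?natrK//.
rewrite -(ler_nat R) natr_sum; under eq_bigr do rewrite -Np.
rewrite -mulr_sumr -norm1_theta ler_piMr ?ltW//.
by have := barycentric_gt0 ord_max; rewrite barycentric_max subr_gt0.
Qed.

Lemma sum_theta_count : (\sum_i M i = N)%N.
Proof.
apply/eqP; rewrite -(eqr_nat R) natr_sum; under eq_bigr do rewrite theta_countE.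
by rewrite -mulr_sumr sum_barycentric mulr1.
Qed.

Lemma theta_count_gt0 i : (0 < M i)%N.
Proof. by rewrite -(ltr0n R) theta_countE mulr_gt0// barycentric_gt0. Qed.

Lemma hypergeometric_pmf_theta (k : lattice_simplex d n) :
  hypergeometric_pmf N n p k = hyper_weight R M k.
Proof. by rewrite /hypergeometric_pmf /hyper_weight sum_theta_count. Qed.

Lemma hyper_mean_at_theta i : hyper_mean_at R n M i = n%:R * barycentric p i.
Proof.
rewrite /hyper_mean_at sum_theta_count theta_countE; field; rewrite gt_eqF//.
Qed.

(** The largest of the d + 1 weights is at least their average. *)
Lemma barycentric_ge i : 1 <= r -> (r * (d%:R + 1))^-1 <= barycentric p i.
Proof.
move=> r1; have r0 : 0 < r by exact: lt_le_trans r1.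
have min0 : 0 < min_weight p by apply: lt_bigmin => // j _; exact: barycentric_gt0.
have mini : min_weight p <= barycentric p i by exact: bigmin_le_cond.
have max1 : 1 <= max_weight p * (d%:R + 1).
  rewrite natr1 -[leLHS]sum_barycentric mulr_natr -[X in _ *+ X]card_ord -sumr_const.
  by apply: ler_sum => j _; exact: le_bigmax.
have /[!ler_pdivrMr]// : max_weight p / min_weight p <= r by case: pT.
move=> mm.
have d1 : 0 < d%:R + 1 :> R by rewrite addr_gt0// (lt_le_trans ltr01).
have rd : 0 < r * (d%:R + 1) by exact: mulr_gt0.
rewrite -[leLHS]mul1r ler_pdivrMr//.
apply: (le_trans max1).
rewrite mulrA; apply: ler_wpM2r; first exact: ltW.
by apply: (le_trans mm); rewrite [leRHS]mulrC; apply: ler_wpM2l => //; exact: ltW.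
Qed.

Lemma hyper_mean_at_inv_le i : 1 <= r ->
  (hyper_mean_at R n M i)^-1 <= 2 * r * d%:R / n%:R.
Proof.
move=> r1; have r0 : 0 < r by exact: lt_le_trans r1.
rewrite hyper_mean_at_theta invfM mulrC ler_pM2r ?invr_gt0//.
have := barycentric_ge i r1.
have rd : 0 < r * (d%:R + 1) by rewrite mulr_gt0//; lra.
rewrite -lef_pV2 ?posrE ?invr_gt0 ?barycentric_gt0// invrK => h.
apply: (le_trans h); rewrite (_ : 2 * r * d%:R = r * (2 * d%:R)); last by ring.
by apply: ler_wpM2l; [exact: ltW|have := dR; lra].
Qed.

Definition theta_mean : 'rV[R]_d := n%:R *: p.
Definition theta_rest : R := n%:R * (1 - norm1 p).
Local Notation a := theta_mean.
Local Notation b := theta_rest.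

Lemma theta_mean_gt0 i : 0 < a 0 i.
Proof. by rewrite mxE mulr_gt0//; have /andP[] := p01 i. Qed.

Lemma theta_rest_gt0 : 0 < b.
Proof.
by rewrite mulr_gt0//; have := barycentric_gt0 ord_max; rewrite barycentric_max.
Qed.

Lemma theta_mean_lift i : hyper_mean_at R n M (lift ord_max i) = a 0 i.
Proof. by rewrite hyper_mean_at_theta barycentric_lift mxE. Qed.

Lemma theta_mean_max : hyper_mean_at R n M ord_max = b.
Proof. by rewrite hyper_mean_at_theta barycentric_max. Qed.

Lemma theta_mean_sum : b + \sum_i a 0 i = n%:R.
Proof.
under eq_bigr do rewrite mxE.
by rewrite -mulr_sumr -norm1_theta /b; ring.
Qed.

Lemma multinomial_cov_theta : n%:R *: multinomial_cov p = scaled_cov a b.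
Proof.
rewrite /multinomial_cov /scaled_cov theta_mean_sum /a.
rewrite scalerBr; congr (_ - _).
  by apply/matrixP => i j; rewrite !mxE mulrnAr.
have -> : (n%:R *: p)^T = n%:R *: p^T by apply/matrixP => i j; rewrite !mxE.
by rewrite -scalemxAl -scalemxAr !scalerA mulVf ?mul1r// gt_eqF.
Qed.

Lemma gauss_log_const_theta : gauss_log_const a b = normal_log_const R n M.
Proof.
rewrite /gauss_log_const /normal_log_const theta_mean_sum big_ord_recr/= theta_mean_max.
under [X in _ = (_ + (X + _) - _) / _]eq_bigr do rewrite widen_lift_max theta_mean_lift.
by rewrite addrA.
Qed.

Lemma gauss_quad_cell_mean_theta (k : lattice_simplex d n) : gauss_quad_cell_mean a b k =
  \sum_i ((lattice_barycentric k i)%:R - hyper_mean_at R n M i) ^+ 2 / hyper_mean_at R n M i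
  + (\sum_i 12^-1 / a 0 i + d%:R / 12 / b).
Proof.
rewrite /gauss_quad_cell_mean [in RHS]big_ord_recr/=.
under [X in _ = X + _ + _]eq_bigr do
  rewrite lattice_barycentric_widen widen_lift_max theta_mean_lift.
under eq_bigr do rewrite mulrDl.
rewrite big_split/= mulrDl theta_mean_max.
have -> : (\sum_i (lattice_point k i - a 0 i)) ^+ 2 =
    ((lattice_barycentric k ord_max)%:R - b) ^+ 2 :> R.
  have := sum_lattice_barycentric k => /(congr1 (fun m => m%:R : R)).
  rewrite natr_sum big_ord_recr/=.
  under eq_bigr do rewrite lattice_barycentric_widen.
  rewrite -theta_mean_sum sumrB /lattice_point.
  move: (\sum_i _) (\sum_i _) (_%:R) => A B D /(canRL (addrK _)) ->.
  by ring.
by rewrite addrACA.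
Qed.

End theta.

(** * Comparison of the two experiments *)

Section comparison.
Context {R : realType}.
Local Notation RR := (measurableTypeR R).
Variables (d n N : nat) (r : R) (p : 'rV[R]_d).
Hypotheses (d0 : (0 < d)%N) (n0 : (0 < n)%N) (N0 : (0 < N)%N) (pT : Theta d N r p).
Hypotheses (r1 : 1 <= r) (nN : n%:R <= 3 / 4 * N%:R :> R).
Hypothesis nNd : n%:R ^+ 3 / d%:R ^+ 2 <= N%:R :> R.

Local Notation M := (theta_count N p).
Local Notation l := (hyper_mean_at R n M).
Local Notation a := (theta_mean n p).
Local Notation b := (theta_rest n p).
Local Notation P := (hypergeometric N n p).
Local Notation Q := (mvnormal (n%:R *: p) (n%:R *: multinomial_cov p)).

Let NR : 0 < N%:R :> R. Proof. by rewrite ltr0n. Qed.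
Let nR : 0 < n%:R :> R. Proof. by rewrite ltr0n. Qed.
Let dR : 1 <= d%:R :> R. Proof. by rewrite ler1n. Qed.

Let ltnN : (n < N)%N.
Proof. by rewrite -(ltr_nat R); apply: (le_lt_trans nN); rewrite gtr_pMl//; lra. Qed.

Let sumM : (\sum_i M i = N)%N. Proof. exact: sum_theta_count N0 pT. Qed.

(** The condition N >= n^3 / d^2 is used through n^2 / N <= d^2 / n. The rest
    is of order 1 / n + sum_i 1 / (n p_i) + d / (n p_(d+1)), and each
    1 / (n p_i) is at most 2 r d / n. *)
Lemma theta_entropy_le : d%:R ^+ 2 < n%:R :> R ->
  \sum_(k : lattice_simplex d n) hypergeometric_pmf N n p k *
    (ln (hypergeometric_pmf N n p k) + gauss_log_const a b
     + gauss_quad_cell_mean a b k / 2) <= 14 * r ^+ 2 * (d%:R ^+ 2 / n%:R).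
Proof.
move=> dn.
have n2 : 1 < n%:R :> R by apply: le_lt_trans dn; rewrite expr_ge1// ltW.
have N2 : (2 < N)%N.
  have : (1 < n)%N by rewrite -(ltr_nat R).
  by move=> n1; apply: leq_trans ltnN; rewrite ltnS.
under eq_bigr do rewrite (hypergeometric_pmf_theta N0 pT)
  (gauss_log_const_theta n N0 pT) (gauss_quad_cell_mean_theta N0 pT).
set B := (\sum_i 12^-1 / a 0 i + d%:R / 12 / b).
have := @hyper_relative_entropy_le R d n M; rewrite sumM.
move=> /(_ n0 N0 (theta_count_gt0 N0 pT) nN ltnN N2 B) h; apply: (le_trans h).
pose D := d%:R ^+ 2 / n%:R : R; rewrite -/D.
pose U := 2 * r * d%:R / n%:R : R.
have D0 : 0 <= D by rewrite divr_ge0 ?sqr_ge0// ltW.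
have r0 : 0 < r by exact: lt_le_trans r1.
have U0 : 0 <= U by rewrite divr_ge0 ?mulr_ge0// ltW.
have UD : d%:R * U = 2 * r * D by rewrite /U /D; ring.
have U2r : U <= 2 * r.
  rewrite ler_pdivrMr// ler_wpM2l ?mulr_ge0 ?ltW//.
  by apply: le_lt_trans dn; rewrite expr2 ler_peMl// ltW// (lt_le_trans ltr01).
have t1 : 4 * n%:R ^+ 2 / N%:R <= 4 * D.
  rewrite -mulrA ler_wpM2l// /D ler_pdivrMr// mulrAC ler_pdivlMr//.
  rewrite -exprSr mulrC -ler_pdivrMr// exprn_gt0// (lt_le_trans ltr01)//.
have t2 : (4 * n%:R)^-1 <= D / 4.
  have -> : (4 * n%:R)^-1 = 1 / n%:R / 4 :> R by field; rewrite gt_eqF.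
  by rewrite /D !ler_pM2r ?invr_gt0// expr_ge1// ltW.
have u i : (l i)^-1 <= U by exact: hyper_mean_at_inv_le d0 n0 N0 pT i r1.
have l0 i : 0 < l i by apply: hyper_mean_at_gt0; rewrite ?sumM// => j; exact: theta_count_gt0 N0 pT _.
have t3 : \sum_i (4 * l i + 1) / (6 * l i ^+ 2) <= (d%:R + 1) * (U * ((4 + 2 * r) / 6)).
  rewrite natr1 [leRHS]mulr_natl -[X in _ <= _ *+ X]card_ord -sumr_const.
  apply: ler_sum => i _.
  have -> : (4 * l i + 1) / (6 * l i ^+ 2) = (l i)^-1 * ((4 + (l i)^-1) / 6).
    by field; rewrite gt_eqF.
  apply: ler_pM => //; first by rewrite invr_ge0 ltW.
    by rewrite divr_ge0// addr_ge0// invr_ge0 ltW.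
  by rewrite ler_pM2r// lerD2l; exact: le_trans (u i) U2r.
have t4 : B <= d%:R * U / 6.
  have -> : d%:R * U / 6 = (\sum_(i < d) 12^-1 * U) + d%:R / 12 * U.
    by rewrite sumr_const card_ord -mulr_natr; field.
  apply: lerD.
    apply: ler_sum => i _; rewrite ler_wpM2l//.
    by rewrite -(theta_mean_lift n N0 pT).
  apply: ler_wpM2l; first exact: divr_ge0.
  by rewrite -(theta_mean_max n N0 pT).
have t5 : (d%:R + 1) * (U * ((4 + 2 * r) / 6)) <= 2 * (2 * r * D) * ((4 + 2 * r) / 6).
  rewrite -UD mulrA ler_wpM2r//; first by rewrite divr_ge0// addr_ge0// mulr_ge0// ltW.
  by rewrite mulrA; apply: ler_wpM2r => //; have := dR; lra.
have r2 : r <= r ^+ 2 by rewrite expr2 ler_peMl// ltW.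
rewrite UD in t4.
have rD : r * D <= r ^+ 2 * D by rewrite ler_wpM2r.
have DD : D <= r ^+ 2 * D by rewrite ler_peMl// (le_trans r1).
have e5 : 2 * (2 * r * D) * ((4 + 2 * r) / 6) = 8 / 3 * (r * D) + 4 / 3 * (r ^+ 2 * D).
  by field.
rewrite e5 in t5.
have e4 : 2 * r * D / 6 = (r * D) / 3 by field.
rewrite e4 in t4.
rewrite -(mulrA 14).
have t3' := le_trans t3 t5.
have r20 : 0 <= r ^+ 2 by exact: sqr_ge0.
clear h t3 t5 e5 e4 UD u U2r.
move: (\sum_i _) (4 * _ / N%:R) ((4 * n%:R)^-1) t1 t2 t3' => S Z W t1 t2 t3'.
clearbody D U B; move: (r ^+ 2 * D) (r * D) rD DD t3' t4 => X Y rD DD t3' t4.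
lra.
Qed.

Let eps : R := d%:R / Num.sqrt n%:R.

Let sn0 : 0 < Num.sqrt n%:R :> R. Proof. by rewrite sqrtr_gt0. Qed.
Let eps0 : 0 < eps. Proof. by rewrite divr_gt0// (lt_le_trans ltr01). Qed.
Let eps2 : eps ^+ 2 = d%:R ^+ 2 / n%:R.
Proof. by rewrite expr_div_n sqr_sqrtr// ltW. Qed.

Lemma mvnormal_theta_setT : Q setT = 1%E.
Proof.
rewrite (multinomial_cov_theta n0 pT); apply: mvnormal_setT.
  exact: theta_mean_gt0 n0 pT.
exact: theta_rest_gt0 n0 pT.
Qed.

Lemma sum_hypergeometric_pmf : \sum_(k : lattice_simplex d n) hypergeometric_pmf N n p k = 1.
Proof.
under eq_bigr do rewrite (hypergeometric_pmf_theta N0 pT).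
by apply: hyper_sum1; rewrite sumM ltnW.
Qed.

Lemma hypergeometric_setT : P setT = 1%E.
Proof.
rewrite hypergeometricE; under eq_bigr do rewrite diracT mule1.
by rewrite sumEFin sum_hypergeometric_pmf.
Qed.

Lemma kernel_mix_cellE A : kernel_mix (@cell_kernel R d n) P A =
  (\sum_(k : lattice_simplex d n) (hypergeometric_pmf N n p k)%:E *
    lebesgue_tuple d (A `&` lattice_cell k))%E.
Proof. by rewrite /kernel_mix integral_hypergeometric. Qed.

Definition comparison_error : R := (7 * r ^+ 2 + 2) * eps.

(** If n <= d^2, the error term exceeds 1 and there is nothing to prove.
    Otherwise e = d / sqrt n in smoothed_le balances the two error terms. *)
Lemma smoothed_hypergeometric_le (A : set (d.-tuple RR)) : measurable A ->
  (kernel_mix (@cell_kernel R d n) P A <= Q A + comparison_error%:E)%E.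
Proof.
move=> mA.
have r2 : 1 <= r ^+ 2 by rewrite expr_ge1// (le_trans ler01).
have [dn|nd] := ltP (d%:R ^+ 2) (n%:R : R); last first.
  have eps1 : 1 <= eps.
    have : 1 ^+ 2 <= eps ^+ 2 by rewrite expr1n eps2 ler_pdivlMr// mul1r.
    by rewrite ler_pXn2r ?nnegrE ?ler01// ltW.
  apply: (@le_trans _ _ 1%E).
    rewrite -hypergeometric_setT -(kernel_mixT (@cell_kernel R d n)).
    rewrite !kernel_mix_cellE; apply: lee_sum => k _.
    apply: lee_wpmul2l; first by rewrite lee_fin hypergeometric_pmf_ge0.
    apply: le_measure; rewrite ?inE//.
    - by apply: measurableI => //; exact: measurable_lattice_cell.
    - by apply: measurableI => //; exact: measurable_lattice_cell.
    - exact: setSI.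
  apply: (@le_trans _ _ comparison_error%:E); last by rewrite leeDr// measure_ge0.
  rewrite lee_fin /comparison_error; nra.
rewrite kernel_mix_cellE (multinomial_cov_theta n0 pT).
have := @smoothed_le R d n a b (theta_mean_gt0 n0 pT) (theta_rest_gt0 n0 pT)
  (hypergeometric_pmf N n p) (hypergeometric_pmf_ge0 _ _) sum_hypergeometric_pmf
  A eps mA eps0.
move=> h; apply: (le_trans h); apply: leeD => //; rewrite lee_fin.
have := theta_entropy_le dn; rewrite -eps2.
move: (\sum_k _) => S hS.
rewrite /comparison_error [leRHS]mulrDl; apply: lerD => //.
have e20 : 0 < 2 * eps by apply: mulr_gt0.
rewrite ler_pdivrMr//; apply: (le_trans hS); rewrite le_eqVlt; apply/orP; left; apply/eqP.
by ring.
Qed.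

Lemma round_cell_preimage (U : set (lattice_simplex d n)) (k : lattice_simplex d n) :
  lebesgue_tuple d ((@round_lattice R d n @^-1` U) `&` lattice_cell k) = (\d_k U : \bar R).
Proof.
have [kU|kU] := pselect (U k).
  rewrite (_ : _ `&` _ = lattice_cell k) ?lattice_cell_measure ?diracE ?mem_set//.
  apply/seteqP; split => t /=; first by case.
  by move=> kt; split => //; rewrite (round_lattice_cell kt).
rewrite (_ : _ `&` _ = set0) ?measure0 ?diracE ?memNset//.
by apply/seteqP; split => t //= -[Ut kt]; apply: kU; rewrite -(round_lattice_cell kt).
Qed.

(** Rounding recovers the centre of a cell, so that the hypergeometric law is
    the image of its smoothed version: the comparison on R^d is applied to the
    preimage of U. *)
Lemma hypergeometric_le_rounded (U : set (lattice_simplex d n)) :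
  (P U <= kernel_mix (kdirac (@measurable_round_lattice R d n)) Q U + comparison_error%:E)%E.
Proof.
have mU : measurable (@round_lattice R d n @^-1` U).
  by rewrite -[X in measurable X]setTI; exact: measurable_round_lattice.
have -> : kernel_mix (kdirac (@measurable_round_lattice R d n)) Q U =
    Q (@round_lattice R d n @^-1` U).
  transitivity (\int[Q]_t (\1_(@round_lattice R d n @^-1` U) t)%:E)%E.
    by apply: eq_integral => t _; rewrite /= diracE indicE.
  by rewrite integral_indic// setIT.
apply: le_trans (smoothed_hypergeometric_le mU).
rewrite kernel_mix_cellE hypergeometricE le_eqVlt; apply/orP; left; apply/eqP.
by apply: eq_bigr => k _; rewrite round_cell_preimage.
Qed.

Lemma tv_norm_smoothed_le :
  (tv_norm (fun A => kernel_mix (@cell_kernel R d n) P A - Q A) <= (2 * comparison_error)%:E)%E.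
Proof.
have [] // := @tv_norm_le_one_sided R _ _ (kernel_mix (@cell_kernel R d n) P) Q comparison_error.
- exact: kernel_mix_additive.
- by move=> m S F mF tF; rewrite measure_bigsetU_ord.
- exact: kernel_mix_ge0.
- exact: etrans (kernel_mixT _ _) hypergeometric_setT.
- exact: mvnormal_theta_setT.
- exact: smoothed_hypergeometric_le.
Qed.

Lemma tv_norm_rounded_le :
  (tv_norm (fun U => kernel_mix (kdirac (@measurable_round_lattice R d n)) Q U - P U)
    <= (2 * comparison_error)%:E)%E.
Proof.
have [] // := @tv_norm_le_one_sided R _ _ P (kernel_mix (kdirac (@measurable_round_lattice R d n)) Q) comparison_error.
- by move=> m S F mF tF; rewrite measure_bigsetU_ord.
- exact: kernel_mix_additive.
- exact: kernel_mix_ge0.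
- exact: hypergeometric_setT.
- exact: etrans (kernel_mixT _ _) mvnormal_theta_setT.
- by move=> U _; exact: hypergeometric_le_rounded.
Qed.

End comparison.

Lemma deficiency_le {R : realType} d1 d2 (X : measurableType d1) (Y : measurableType d2)
    (I : Type) (D : set I) (P : I -> {measure set X -> \bar R})
    (Q : I -> {measure set Y -> \bar R}) (K : R.-pker X ~> Y) (e : R) :
  0 <= e ->
  (forall p, D p -> (tv_norm (fun U => kernel_mix K (P p) U - Q p U) <= e%:E)%E) ->
  (deficiency D P Q <= e%:E)%E.
Proof.
move=> e0 H; apply: (@le_trans _ _ (ereal_sup (0%E |`
      [set tv_norm (fun U => kernel_mix K (P p) U - Q p U)%E | p in D]))).
  by apply: ereal_inf_lbound; exists K.
apply: ge_ereal_sup => _ [->|[p Dp <-]]; first by rewrite lee_fin.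
exact: H.
Qed.

Theorem theorem3 (R : realType) (r : R) (hr : 1 <= r) :
  exists C : R, 0 < C /\
    forall d n N : nat, (0 < d)%N -> (0 < n)%N -> (0 < N)%N ->
      n%:R <= 3 / 4 * N%:R :> R ->
      n%:R ^+ 3 / d%:R ^+ 2 <= N%:R :> R ->
      (le_cam_distance (Theta d N r)
         (fun p => hypergeometric N n p)
         (fun p => mvnormal (n%:R *: p) (n%:R *: multinomial_cov p))
       <= (C * (d%:R / Num.sqrt n%:R))%:E)%E.
Proof.
have r20 : 0 <= r ^+ 2 by exact: sqr_ge0.
exists (2 * (7 * r ^+ 2 + 2)); split; first lra.
move=> d n N d0 n0 N0 nN nNd.
have e0 : 0 <= 2 * (7 * r ^+ 2 + 2) * (d%:R / Num.sqrt n%:R).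
  by rewrite mulr_ge0 ?divr_ge0 ?sqrtr_ge0//; lra.
rewrite /le_cam_distance ge_max; apply/andP; split.
  apply: (deficiency_le (K := @cell_kernel R d n)) => // p pT.
  rewrite -mulrA; exact: tv_norm_smoothed_le.
apply: (deficiency_le (K := kdirac (@measurable_round_lattice R d n))) => // p pT.
rewrite -mulrA; exact: tv_norm_rounded_le.
Qed.
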